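(* Let $n\ge 2$ and let $Q\in L^\infty_{\rm loc}(\mathbb{R}^n)$ be a radial function such that, for some $p\ge 0$ and $M\ge 1$, $$Q(x)\ge 1+|x|^p\quad\text{and}\quad (Q-M|x|^p)^+\in L^1(\mathbb{R}^n).$$ Then for every $\alpha>-1$ there exists a constant $$C=C\left(n,p,M,\alpha,\|Q\|_{L^\infty(B_1)},\|(Q-M|x|^p)^+\|_{L^1(B_1^c)}\right)>0$$ (depending only on the listed quantities) such that for every radial normal solution $u$ of $(-\Delta)^{n/2}u=|x|^{n\alpha}Qe^{nu}$ in $\mathbb{R}^n$ with $\int_{\mathbb{R}^n}|x|^{n\alpha}|Q|e^{nu}\,dx<\infty$, the total curvature $\Lambda_*:=\int_{\mathbb{R}^n}Q|x|^{n\alpha}e^{nu}\,dx$ satisfies $$\Lambda_*\le C .$$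
   Context: Notation: $B_1$ is the unit ball of $\mathbb{R}^n$ centered at the origin, $B_1^c$ its complement, $t^+=\max\{t,0\}$; $\gamma_n:=\frac{(n-1)!}{2}|\mathbb{S}^n|$, where $|\mathbb{S}^n|$ is the surface measure of the unit sphere in $\mathbb{R}^{n+1}$. A normal solution of $(-\Delta)^{n/2}u=|x|^{n\alpha}Qe^{nu}$ with $|x|^{n\alpha}Qe^{nu}\in L^1(\mathbb{R}^n)$ is a function $u$ satisfying, for some $c\in\mathbb{R}$, the integral equation $$u(x)=\frac{1}{\gamma_n}\int_{\mathbb{R}^n}\log\left(\frac{1+|y|}{|x-y|}\right)|y|^{n\alpha}Q(y)e^{nu(y)}\,dy+c .$$ For $Q\in L^\infty_{\rm loc}$ and $\alpha>-1$ such $u$ is continuous on $\mathbb{R}^n$ and $C^1$ on $\mathbb{R}^n\setminus\{0\}$. Inequalities for $Q$ are understood almost everywhere. *)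

(* Defs.v *)
From HB Require Import structures.
From mathcomp Require Import all_boot all_order all_algebra.
From mathcomp Require Import all_classical all_reals all_analysis.

Set Implicit Arguments.
Unset Strict Implicit.
Unset Printing Implicit Defensive.

Import Order.TTheory GRing.Theory Num.Theory.
Import numFieldNormedType.Exports.

Local Open Scope classical_set_scope.
Local Open Scope ring_scope.

(* R^n as n-tuples of reals.  The library's sigma-algebra on tuples is the one
   generated by the coordinates, i.e. the Borel sigma-algebra of R^n. *)
Notation Rn R n := (n.-tuple (measurableTypeR R)).

(* Lebesgue measure on R^n, as the n-fold product of Lebesgue measures on R:
   the image of lebesgue_measure \x (measure on R^n) under (a, x) |-> a :: x. *)
Section lebesgue_measure_Rn.
Context (R : realType).
Let TR := measurableTypeR R.

Definition tcons n (z : TR * n.-tuple TR) : n.+1.-tuple TR :=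
  [tuple of z.1 :: z.2].

Lemma measurable_tcons n : measurable_fun setT (@tcons n).
Proof. exact: measurable_cons. Qed.

Definition lebesgue_cons n
    (mu : {sigma_finite_measure set (n.-tuple TR) -> \bar R}) :=
  pushforward (@lebesgue_measure R \x mu)%E (@tcons n).

Section lebesgue_cons_measure.
Context n (mu : {sigma_finite_measure set (n.-tuple TR) -> \bar R}).

Let mu0 : lebesgue_cons mu set0 = 0%E.
Proof. by rewrite /lebesgue_cons /pushforward preimage_set0 measure0. Qed.

Let mu_ge0 A : (0 <= lebesgue_cons mu A)%E.
Proof. by rewrite /lebesgue_cons /pushforward measure_ge0. Qed.

Let mu_sigma_additive : semi_sigma_additive (lebesgue_cons mu).
Proof.
move=> F mF tF mUF; rewrite /lebesgue_cons /pushforward preimage_bigcup.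
apply: measure_semi_sigma_additive.
- by move=> i; rewrite -[X in measurable X]setTI; exact: measurable_tcons.
- apply/trivIsetP => /= i j _ _ ij; rewrite -preimage_setI.
  by move/trivIsetP : tF => /(_ _ _ _ _ ij) ->//; rewrite preimage_set0.
- by rewrite -preimage_bigcup -[X in measurable X]setTI; exact: measurable_tcons.
Qed.

HB.instance Definition _ := isMeasure.Build _ _ _ (lebesgue_cons mu)
  mu0 mu_ge0 mu_sigma_additive.

Let lebesgue_cons_sigma_finite : sigma_finite setT (lebesgue_cons mu).
Proof.
have /sigma_finiteP[F [TF ndF Foo]] := sigma_finiteT (@lebesgue_measure R).
have /sigma_finiteP[G [TG ndG Goo]] := sigma_finiteT mu.
pose H k := [set x : n.+1.-tuple TR | F k (thead x)] `&`
            [set x : n.+1.-tuple TR | G k [tuple of behead x]].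
exists H.
  apply/seteqP; split => // x _.
  have [i _ Fi] : (\bigcup_i F i) (thead x) by rewrite -TF.
  have [j _ Gj] : (\bigcup_i G i) [tuple of behead x] by rewrite -TG.
  exists (maxn i j) => //; split => /=.
  - by move: Fi; exact/subsetPset/ndF/leq_maxl.
  - by move: Gj; exact/subsetPset/ndG/leq_maxr.
move=> k; have [mF Fk] := Foo k; have [mG Gk] := Goo k; split.
  apply: measurableI; rewrite -[X in measurable X]setTI.
    exact: (measurable_tnth ord0).
  exact: (measurable_behead (T := TR) (n := n)).
rewrite /lebesgue_cons /pushforward (_ : _ @^-1` _ = F k `*` G k).
  by rewrite product_measure1E// lte_mul_pinfty// ge0_fin_numE.
have tconsK (z : TR * n.-tuple TR) : [tuple of behead (tcons z)] = z.2.
  exact: val_inj.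
by apply/seteqP; split => z; rewrite /H /= tconsK.
Qed.

HB.instance Definition _ :=
  Measure_isSigmaFinite.Build _ _ _ (lebesgue_cons mu)
    lebesgue_cons_sigma_finite.
End lebesgue_cons_measure.

Fixpoint lebesgue_Rn n : {sigma_finite_measure set (n.-tuple TR) -> \bar R} :=
  match n with
  | 0 => [the {sigma_finite_measure set (0.-tuple TR) -> \bar R} of
           dirac ([tuple] : 0.-tuple TR)]
  | n'.+1 => [the {sigma_finite_measure set (n'.+1.-tuple TR) -> \bar R} of
               lebesgue_cons (lebesgue_Rn n')]
  end.

Lemma lebesgue_Rn_box n (A : 'I_n -> set TR) : (forall i, measurable (A i)) ->
  lebesgue_Rn n [set x | forall i, A i (tnth x i)] =
  (\prod_(i < n) lebesgue_measure (A i))%E.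
Proof.
elim: n A => [|n IH] A mA.
  by rewrite big_ord0 /= diracE mem_set//= => -[].
have mB : measurable
    [set x : n.-tuple TR | forall i, A (lift ord0 i) (tnth x i)].
  rewrite (_ : [set _ | _] =
      \bigcap_(i in setT) ((@tnth n TR)^~ i @^-1` A (lift ord0 i))); last first.
    by apply/seteqP; split => [x H i _|x H i]; [exact: H | exact: (H i I)].
  apply: fin_bigcap_measurable => // i _.
  by rewrite -[X in measurable X]setTI; exact: measurable_tnth.
rewrite big_ord_recl -(IH (fun i => A (lift ord0 i)))// -product_measure1E//.
rewrite /= /lebesgue_cons/pushforward; congr ((_ \x _)%E _).
apply/seteqP; split => [[a t] /= H|[a t] /= [H0 H1] i].
  split; first exact: (H ord0).
  by move=> i; have := H (lift ord0 i); rewrite tnthS.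
by case: (unliftP ord0 i) => [j|] ->; rewrite ?tnthS//; exact: H1.
Qed.
End lebesgue_measure_Rn.

Section euclidean.
Context (R : realType) (n : nat).
Implicit Types x y : Rn R n.

Definition enorm x : R := Num.sqrt (\sum_(i < n) (tnth x i : R) ^+ 2).

Definition vsub x y : Rn R n := [tuple (tnth x i : R) - tnth y i | i < n].

Definition vscale (r : R) x : Rn R n := [tuple r * (tnth x i : R) | i < n].

Definition oball (r : R) : set (Rn R n) := [set x | enorm x < r].

Definition usphere : set (Rn R n) := [set x | enorm x = 1].

(* (n-1)-dimensional surface measure of a subset A of the unit sphere of R^n,
   through polar coordinates: n times the volume of the truncated cone
   {r x | x \in A, 0 < r <= 1}. *)
Definition surface_measure (A : set (Rn R n)) : \bar R :=
  (n%:R%:E * lebesgue_Rn R n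
     [set y | exists (r : R) x, [/\ (0 < r <= 1)%R, A x & y = vscale r x]])%E.

(* L^p norm of f on D (p = +oo is the essential supremum of |f|). *)
Definition Lnorm_on (p : \bar R) (D : set (Rn R n)) (f : Rn R n -> R) : \bar R :=
  Lnorm (lebesgue_Rn R n) p ((EFin \o f) \_ D).

Definition Linfty_loc (f : Rn R n -> R) : Prop :=
  measurable_fun setT f /\
  forall r : R, (Lnorm_on +oo%E (oball r) f < +oo)%E.

Definition radial (f : Rn R n -> R) : Prop :=
  forall x y, enorm x = enorm y -> f x = f y.

(* Radial as an element of L^infty_loc, whose elements are classes of functions
   modulo almost everywhere equality. *)
Definition ae_radial (f : Rn R n -> R) : Prop :=
  exists2 q : R -> R, measurable_fun setT q &
    \forall x \ae lebesgue_Rn R n, f x = q (enorm x).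

End euclidean.

Section normal_solution.
Context (R : realType) (n : nat).

Definition gamma_const : R :=
  (n.-1)`!%:R / 2 * fine (surface_measure (@usphere R n.+1)).

Definition curvature_density (alpha : R) (Q u : Rn R n -> R) (x : Rn R n) : R :=
  enorm x `^ (n%:R * alpha) * Q x * expR (n%:R * u x).

(* The integral is extended-real valued and is computed as the integral of the
   positive part minus that of the negative part, with +oo - +oo = -oo.  As the
   left-hand side is a real number, the equation forces both parts to be
   finite, i.e. the integral converges absolutely, at every point x. *)
Definition normal_solution (alpha : R) (Q u : Rn R n -> R) : Prop :=
  measurable_fun setT u /\
  exists c : R, forall x : Rn R n,
    (u x)%:E = ((gamma_const^-1)%:E *
      (\int[lebesgue_Rn R n]_y
         (ln ((1 + enorm y) / enorm (vsub x y)) *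
          curvature_density alpha Q u y)%:E) + c%:E)%E.

(* (Q - M |x|^p)^+ *)
Definition excess (p M : R) (Q : Rn R n -> R) (x : Rn R n) : R :=
  Num.max (Q x - M * enorm x `^ p) 0.

End normal_solution.

(* Main.v *)
Require Import Defs.
From HB Require Import structures.
From mathcomp Require Import all_boot all_order all_algebra.
From mathcomp Require Import all_classical all_reals all_analysis.
From mathcomp Require Import measurable_realfun ess_sup_inf ring lra.

Set Implicit Arguments.
Unset Strict Implicit.
Unset Printing Implicit Defensive.

Import Order.TTheory GRing.Theory Num.Theory.
Import numFieldNormedType.Exports.

Local Open Scope classical_set_scope.
Local Open Scope ring_scope.

(** The solution enters through its profile U and the mass m r of the ball of
    radius r, for the density K = |x|^(n alpha) |Q| e^(n u).  Everything rests on
    two properties of U: it is non-increasing, and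
    U (4 r) <= U r - (ln 2 / gamma_n) m r ([profile_drop]).

    Granted these, put w_k r = r^k e^(n U r) for k = n (1 + alpha) and for
    k = n (1 + alpha) + p.  As Q >= 1 and Q >= |x|^p, the mass m (r / 4) is at least
    a constant times w_k r ([ball_mass_low]); if w_k r is large, U is
    therefore much larger at r / 4 than at r, and w_k (r / 4) >= 2 w_k r.  Iterating
    towards the origin would make w_k unbounded, whereas it is at most a multiple
    of the total mass.  So w_k is bounded by a constant independent of u.  In the
    other direction, the mass of the shell r <= |x| < 4 r is at most a constant
    times the sum of the two w_k r ([ball_mass_up]): the sup norm of Q on the unit
    ball is used inside it, the bound M |x|^p and the integral of the excess are
    used outside.  Once m r exceeds a certain threshold, the drop of U halves w_k
    from r to 4 r, so that the masses of the successive shells beyond r are summed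
    by a geometric series.  The total mass is thus at most the threshold, plus
    one shell, plus this series ([radial_mass_bound]).

    For the two properties of U, u is averaged over the circle of radius r in the
    plane of the first two coordinates, which does not change u.  The circular
    mean of ln |x - y| is ln a, where a = a_r y is explicit by Jensen's formula,
    non-decreasing in r for every y, and at least doubled from r to 4 r when
    |y| < r; averaging the integral equation over two circles then gives both
    properties ([profile_noninc], [profile_drop]).  The exchange of the mean with
    the integral is done with regular 2^k-gons instead of circles: the product of
    the squared distances from y to the vertices is computed exactly, by
    duplication of the angle, and exhibits an error of order 2^-k away from the
    vertices.  The logarithmic singularities at the vertices are removed by
    averaging, with Tonelli's theorem, over a rotation of the polygon, after which
    the error is O(2^-k) uniformly in y ([potential_compare]). *)

(** * Means over regular polygons of the logarithm of A - p cos t - q sin t *)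

Section circle_average.
Context (R : realType).
Implicit Types (f : R -> R) (w : R * R * R) (t : R).

(** The k-th iterate at t is the average of f over the 2^k angles congruent to
    t / 2^k modulo 2 pi / 2^k, that is, over a regular polygon.  Unlike an
    integral over the circle, such a finite average commutes with any other
    integral at no cost, and the recursive form applies the duplication formula
    one step at a time. *)
Definition half_angle_mean f t : R := (f (t / 2) + f (t / 2 + pi)) / 2.

(** The square of the distance from y to a point moving on a circle has this
    form, w = (A, p, q) standing for A - p cos t - q sin t. *)
Definition trig_poly w t : R := w.1.1 - w.1.2 * cos t - w.2 * sin t.

(** Coefficients of the product of the values at two opposite points, as a
    function of the doubled angle. *)
Definition double_coef w : R * R * R :=
  (w.1.1 ^+ 2 - (w.1.2 ^+ 2 + w.2 ^+ 2) / 2, (w.1.2 ^+ 2 - w.2 ^+ 2) / 2,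
   w.1.2 * w.2).

Definition admissible w := 0 < w.1.1 /\ w.1.2 ^+ 2 + w.2 ^+ 2 <= w.1.1 ^+ 2.

(** If A = x^2 + y^2 and sqrt (p^2 + q^2) = 2 x y with x >= y >= 0, then the apex
    is 2 x^2.  The doubled coefficients correspond to the pair (x^2, y^2), and
    ln (apex / 2) is the mean over the whole circle of the logarithm of the
    trigonometric polynomial (Jensen's formula). *)
Definition apex w : R := w.1.1 + Num.sqrt (w.1.1 ^+ 2 - (w.1.2 ^+ 2 + w.2 ^+ 2)).

Lemma trig_poly_double w t :
  trig_poly w (t / 2) * trig_poly w (t / 2 + pi) = trig_poly (double_coef w) t.
Proof.
case: w => [[A p] q]; rewrite /trig_poly /double_coef /= cosDpi sinDpi.
have /esym ht : t / 2 + t / 2 = t by lra.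
rewrite [in RHS]ht cosD sinD.
have c2 := cos2Dsin2 (t / 2).
set c := cos _ in c2 *; set s := sin _ in c2 *.
transitivity (A ^+ 2 - (p ^+ 2 + q ^+ 2) / 2 * (c ^+ 2 + s ^+ 2) -
   (p ^+ 2 - q ^+ 2) / 2 * (c * c - s * s) - p * q * (s * c + c * s)); first by field.
by rewrite c2 mulr1.
Qed.

(** The equation for f is required only where the argument of the logarithm is
    not zero: the conventional value ln 0 = 0 breaks the addition formula, and
    a zero at any vertex makes the final value vanish too, so that the
    hypothesis on the final value excludes all of them. *)
Lemma iter_half_angle_mean_ln k f w a e t : (forall s, 0 <= trig_poly w s) ->
  (forall s, trig_poly w s != 0 -> f s = a + e * ln (trig_poly w s)) ->
  trig_poly (iter k double_coef w) t != 0 ->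
  iter k half_angle_mean f t = a + e * ln (trig_poly (iter k double_coef w) t) / 2 ^+ k.
Proof.
move=> w0 fE; suff H k' : (forall s, 0 <= trig_poly (iter k' double_coef w) s) /\
    forall s, trig_poly (iter k' double_coef w) s != 0 ->
     iter k' half_angle_mean f s =
     a + e * ln (trig_poly (iter k' double_coef w) s) / 2 ^+ k'.
  by move=> nz; exact: (H k).2.
elim: k' => [|k' [IH0 IH]]; first by split => //= s /fE ->; rewrite expr0 divr1.
split=> s; rewrite iterS -trig_poly_double; first exact: mulr_ge0.
rewrite mulf_eq0 negb_or => /andP[n1 n2]; rewrite iterS /half_angle_mean !IH//.
have p1 : 0 < trig_poly (iter k' double_coef w) (s / 2) by rewrite lt0r n1 IH0.
have p2 : 0 < trig_poly (iter k' double_coef w) (s / 2 + pi) by rewrite lt0r n2 IH0.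
rewrite lnM ?posrE// exprS; field.
by rewrite expf_neq0.
Qed.

Lemma admissible_double w : admissible w -> admissible (double_coef w).
Proof.
case: w => [[A p] q]; rewrite /admissible /double_coef /= => -[A0 h]; split; first nra.
have -> : ((p ^+ 2 - q ^+ 2) / 2) ^+ 2 + (p * q) ^+ 2 =
  ((p ^+ 2 + q ^+ 2) / 2) ^+ 2 by field.
rewrite ler_sqr ?nnegrE; nra.
Qed.

Lemma admissible_iter k w : admissible w -> admissible (iter k double_coef w).
Proof. by move=> h; elim: k => //= k; exact: admissible_double. Qed.

Lemma apex_bounds w : admissible w -> w.1.1 <= apex w <= 2 * w.1.1.
Proof.
case: w => [[A p] q]; rewrite /admissible /apex /= => -[A0 h].
rewrite lerDl sqrtr_ge0 /= mulrDl mul1r lerD2l.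
rewrite -[leRHS]gtr0_norm// -sqrtr_sqr ler_wsqrtr//; nra.
Qed.

Lemma apex_double w : admissible w -> apex (double_coef w) / 2 = (apex w / 2) ^+ 2.
Proof.
case: w => [[A p] q]; rewrite /admissible /apex /double_coef /= => -[A0 h].
have -> : (A ^+ 2 - (p ^+ 2 + q ^+ 2) / 2) ^+ 2 -
    (((p ^+ 2 - q ^+ 2) / 2) ^+ 2 + (p * q) ^+ 2) =
   A ^+ 2 * (A ^+ 2 - (p ^+ 2 + q ^+ 2)) by field.
rewrite sqrtrM ?sqr_ge0// sqrtr_sqr gtr0_norm//.
have : Num.sqrt (A ^+ 2 - (p ^+ 2 + q ^+ 2)) ^+ 2 = A ^+ 2 - (p ^+ 2 + q ^+ 2).
  by rewrite sqr_sqrtr// subr_ge0.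
set D := Num.sqrt _ => D2.
have -> : p ^+ 2 + q ^+ 2 = A ^+ 2 - D ^+ 2 by rewrite D2; ring.
by field.
Qed.

Lemma apex_iter k w : admissible w ->
  apex (iter k double_coef w) / 2 = (apex w / 2) ^+ (2 ^ k).
Proof.
move=> h; elim: k => [|k IH]; first by rewrite expn0 expr1.
by rewrite iterS apex_double; [rewrite IH -exprM expnSr|exact: admissible_iter].
Qed.

(** With P = (p / A, q / A) in the unit disc and v = (cos t, sin t) one has
    1 - P.v >= |P - v|^2 / 2, of which only the second coordinate is kept: this
    reduces the singularity to that of ln |q / A - sin t|. *)
Lemma trig_poly_ge w t : admissible w ->
  w.1.1 * ((w.2 / w.1.1 - sin t) ^+ 2 / 2) <= trig_poly w t.
Proof.
case: w => [[A p] q]; rewrite /admissible /trig_poly /= => -[A0 h].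
have c2 := cos2Dsin2 t; set c := cos t in c2 *; set s := sin t in c2 *.
have An0 : A != 0 by rewrite gt_eqF.
rewrite -(ler_pM2r A0) [leLHS](_ : _ = (q - s * A) ^+ 2 / 2); last by field.
suff : 0 <= (p - c * A) ^+ 2 + (A ^+ 2 - (p ^+ 2 + q ^+ 2)).
  move=> H; rewrite -subr_ge0.
  have -> : (A - p * c - q * s) * A - (q - s * A) ^+ 2 / 2 =
    ((p - c * A) ^+ 2 + (A ^+ 2 - (p ^+ 2 + q ^+ 2))) / 2
    + A ^+ 2 / 2 * (1 - (c ^+ 2 + s ^+ 2)) by field.
  by rewrite c2 subrr mulr0 addr0 divr_ge0.
by rewrite addr_ge0 ?sqr_ge0// subr_ge0.
Qed.

Lemma trig_poly_ge0 w t : admissible w -> 0 <= trig_poly w t.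
Proof.
move=> h; apply: le_trans (trig_poly_ge t h); case: h => A0 _.
by rewrite mulr_ge0 ?divr_ge0 ?sqr_ge0// ltW.
Qed.

Lemma trig_poly_le w t : admissible w -> trig_poly w t <= 2 * w.1.1.
Proof.
move=> h; have := trig_poly_ge0 (t + pi) h.
rewrite /trig_poly cosDpi sinDpi; lra.
Qed.

(** The polygon average differs from its limit ln (apex / 2) by d / 2^k, where d
    is bounded above by a constant, and below by a logarithm whose location q
    depends on w and k but whose strength does not.  Integrating in t thus makes
    the error O(2^-k) uniformly in w, although d itself is unbounded. *)
Lemma iter_half_angle_mean_ln_bounds k w : admissible w -> exists q : R,
  forall f a e t, (forall s, trig_poly w s != 0 -> f s = a + e * ln (trig_poly w s)) ->
  sin t != q ->
  exists2 d, iter k half_angle_mean f t = a + e * (ln (apex w / 2) + d / 2 ^+ k) &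
    ln ((q - sin t) ^+ 2 / 2) <= d <= ln 4.
Proof.
move=> h; have hk := admissible_iter k h.
set wk := iter k double_coef w in hk *.
exists (wk.2 / wk.1.1) => f a e t fE sq.
have A0 := hk.1.
have ap : 0 < apex w / 2.
  by rewrite divr_gt0//; apply: lt_le_trans (andP (apex_bounds h)).1; case: h.
have apk : apex wk / 2 = (apex w / 2) ^+ (2 ^ k) by exact: apex_iter.
have q0 : 0 < (wk.2 / wk.1.1 - sin t) ^+ 2 / 2.
  by rewrite divr_gt0// exprn_even_gt0//= subr_eq0 eq_sym.
have tge := trig_poly_ge t hk.
have t0 : 0 < trig_poly wk t by apply: lt_le_trans tge; rewrite mulr_gt0.
have apk0 : 0 < apex wk / 2 by rewrite apk exprn_gt0.
exists (ln (trig_poly wk t) - ln (apex wk / 2)).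
  rewrite (iter_half_angle_mean_ln (fun s => trig_poly_ge0 s h) fE) ?gt_eqF//.
  have -> : ln (apex wk / 2) = ln (apex w / 2) * 2 ^+ k.
    by rewrite apk lnXn// -[in LHS](mulr_natr _ (2 ^ k)) natrX.
  by field; rewrite expf_neq0.
have /andP[ab1 ab2] := apex_bounds hk.
apply/andP; split.
  rewrite lerBrDr -lnM ?posrE// ler_ln ?posrE//; last exact: mulr_gt0.
  by apply: le_trans tge; rewrite [leLHS]mulrC ler_wpM2r ?(ltW q0)//; lra.
rewrite lerBlDr -lnM ?posrE// ler_ln ?posrE//; last exact: mulr_gt0.
by apply: le_trans (trig_poly_le t hk) _; lra.
Qed.
End circle_average.

(** * A majorant with bounded integral for the logarithmic singularity *)

Section log_sine.
Context (R : realType).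

(** The mean value theorem and cos >= cos 1 on [0, 1]. *)
Lemma sin_expanding (s t : R) : 0 <= s <= 1 -> 0 <= t <= 1 ->
  cos 1 * `|s - t| <= `|sin s - sin t|.
Proof.
wlog st : s t / t <= s.
  move=> H hs ht; have [|/ltW] := leP t s; first by move=> ts; exact: H.
  by move=> ts; rewrite distrC [leRHS]distrC; exact: H.
move=> /andP[s0 s1] /andP[t0 t1].
have [|c] := @MVT_segment R sin cos t s st.
  exact/continuous_subspaceT/continuous_sin.
rewrite in_itv/= => /andP[tc cs] ->.
have pi1 : (1 : R) <= pi.
  by have := @pi_ge2 R; lra.
have c0 : 0 < cos 1 :> R by exact: cos1_gt0.
have cc : cos 1 <= cos c.
  rewrite leNgt; apply/negP; rewrite ltr_cos ?in_itv/=; lra.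
rewrite normrM (@ger0_norm _ (cos c)); last by lra.
by rewrite ler_wpM2r.
Qed.

Definition near_sin (q : R) (j : nat) := [set t : R | `|q - sin t| <= 2^-1 ^+ j].

Lemma measurable_near_sin q j : measurable (near_sin q j).
Proof.
rewrite /near_sin -[X in measurable X]setTI.
apply: measurable_fun_ler => //; apply: measurableT_comp => //.
apply: measurable_funB => //.
by apply: continuous_measurable_fun; exact: continuous_sin.
Qed.

(** By [sin_expanding], any two points of this set are at distance at most
    (2 / cos 1) 2^-j. *)
Lemma near_sin_le q j :
  (lebesgue_measure (near_sin q j `&` `[0%R, 1%R]) <=
   (8 / cos 1 / (2 ^ j.+1)%:R)%:E :> \bar R)%E.
Proof.
have [->|/set0P[t0 [t0S t0I]]] := eqVneq (near_sin q j `&` `[0, 1]) set0.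
  by rewrite measure0 lee_fin !divr_ge0// ltW// cos1_gt0.
pose e : R := 2 / cos 1 * 2^-1 ^+ j.
have e0 : 0 < e by rewrite mulr_gt0// ?exprn_gt0// divr_gt0// cos1_gt0.
apply: (@le_trans _ _ (lebesgue_measure `[t0 - e, t0 + e])).
  apply: le_measure; rewrite ?inE//.
    by apply: measurableI => //; exact: measurable_near_sin.
  move=> t [tS tI]; rewrite /= in_itv/=.
  have : `|t - t0| <= e.
    rewrite /e mulrAC ler_pdivlMr ?cos1_gt0// mulrC.
    apply: le_trans (sin_expanding _ _) _ => //.
    rewrite (_ : sin t - sin t0 = (q - sin t0) - (q - sin t)); last by ring.
    apply: le_trans (ler_normB _ _) _; rewrite mulrDl mul1r.
    by apply: lerD.
  by rewrite ler_distlC; lra.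
rewrite lebesgue_measure_itv/= lte_fin -EFinD.
case: ifPn => _; rewrite lee_fin.
  rewrite /e natrX -exprVn exprS; set z := 2^-1 ^+ j; lra.
by rewrite !divr_ge0// ltW// cos1_gt0.
Qed.

(** Dyadic layer cake for - ln ((q - sin t)^2 / 2): each halving of |q - sin t|
    adds a bounded amount to the logarithm and one more term to the series.  The
    value is +oo where sin t = q, so that bounds by it hold without exception. *)
Definition log_majorant (q t : R) : \bar R :=
  (1 + 2%:E * \sum_(0 <= j <oo) (\1_(near_sin q j) t)%:E)%E.

Lemma log_majorant_ge0 q t : (0 <= log_majorant q t)%E.
Proof.
rewrite adde_ge0// mule_ge0//.
by apply: nneseries_ge0 => *; rewrite lee_fin indicE.
Qed.

Lemma measurable_near_sin_series q : measurable_fun setT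
  (fun t => \sum_(0 <= j <oo) (\1_(near_sin q j) t : R)%:E)%E.
Proof.
apply: (@ge0_emeasurable_sum _ _ _ _ _ xpredT).
  by move=> k x _ _; rewrite lee_fin indicE.
by move=> k _; apply/measurable_EFinP/measurable_indic; exact: measurable_near_sin.
Qed.

Lemma measurable_log_majorant q : measurable_fun setT (log_majorant q).
Proof.
apply: emeasurable_funD; first exact: measurable_cst.
exact: (measurable_funeM 2%:E (measurable_near_sin_series q)).
Qed.

Lemma integral_log_majorant q :
  (\int[lebesgue_measure]_(t in `[0%R, 1%R]) log_majorant q t <=
   (1 + 2 * (8 / cos 1))%:E)%E.
Proof.
rewrite ge0_integralD//=; last 2 first.
- move=> x _; rewrite mule_ge0//.
  by apply: nneseries_ge0 => *; rewrite lee_fin indicE.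
- apply: (measurable_funS measurableT) => //.
  exact: (measurable_funeM 2%:E (measurable_near_sin_series q)).
rewrite [leRHS]EFinD.
apply: leeD.
  rewrite integral_cst// [X in (_ * X)%E](lebesgue_measure_itv `[0%R, 1%R])/=.
  by rewrite lte01 oppr0 adde0 mul1e.
have mS k : measurable_fun (`[0, 1] : set R)
    (fun t => (\1_(near_sin q k) t : R)%:E).
  by apply/measurable_EFinP/measurable_indic; exact: measurable_near_sin.
rewrite ge0_integralZl//; last 2 first.
- exact: (measurable_funS measurableT) (measurable_near_sin_series q).
- by move=> x _; apply: nneseries_ge0 => *; rewrite lee_fin indicE.
rewrite EFinM lee_pmul2l// integral_nneseries//.
apply: le_trans (@epsilon_trick0 R (8 / cos 1) xpredT _).
  apply: lee_nneseries => [i _ _|j _]; first exact: integral_ge0.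
  by rewrite integral_indic//; [exact: near_sin_le|exact: measurable_near_sin].
by rewrite divr_ge0// ltW// cos1_gt0.
Qed.

Lemma ln2_le1 : ln 2 <= 1 :> R.
Proof. by rewrite -[2]/(1 + 1) le_ln1Dx//; lra. Qed.

Lemma log_near_sin N (q t : R) : q != sin t -> 2^-1 ^+ N < `|q - sin t| ->
  - ln `|q - sin t| <= \sum_(0 <= j < N) \1_(near_sin q j) t.
Proof.
move=> qt; have z0 : 0 < `|q - sin t| by rewrite normr_gt0 subr_eq0.
elim: N => [|N IH] h.
  by rewrite big_nil oppr_le0 ln_ge0// ltW.
have [/IH {}IH|h'] := ltP (2^-1 ^+ N) `|q - sin t|.
  by rewrite big_nat_recr//=; apply: le_trans IH _; rewrite lerDl indicE.
have -> : \sum_(0 <= j < N.+1) \1_(near_sin q j) t = N.+1%:R :> R.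
  rewrite -[X in X%:R]card_ord -sum1_card natr_sum big_mkord.
  apply: eq_bigr => i _; rewrite indicE mem_set//=.
  by apply: le_trans h' _; rewrite ler_wiXn2l ?invf_le1 ?ler1n// -ltnS.
have : ln (2^-1 ^+ N.+1) <= ln `|q - sin t|.
  by rewrite ler_ln ?posrE ?ltW// exprn_gt0.
rewrite lnXn ?invr_gt0// lnV ?posrE// mulNrn.
rewrite lerNl => /le_trans; apply.
have := ln2_le1; rewrite -mulr_natr; have : (0 : R) <= N.+1%:R by [].
by nra.
Qed.

Lemma log_majorantP q t : q != sin t ->
  ((- ln ((q - sin t) ^+ 2 / 2))%:E <= log_majorant q t)%E.
Proof.
move=> qt; have z0 : 0 < `|q - sin t| by rewrite normr_gt0 subr_eq0.
have [N hN] : exists N : nat, (2^-1 : R) ^+ N < `|q - sin t|.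
  have [N _ /(_ N (leqnn N)) /=] : \forall n \near \oo,
     `|(2^-1 : R) ^+ n| < `|q - sin t|.
    have : (fun n => (2^-1 : R) ^+ n) @ \oo --> (0 : R).
      by apply: cvg_expr; rewrite ger0_norm//; lra.
    by move=> /cvgr0Pnorm_lt; apply.
  by rewrite ger0_norm ?exprn_ge0// => ?; exists N.
have := log_near_sin qt hN.
have -> : (- ln ((q - sin t) ^+ 2 / 2)) = ln 2 + 2 * (- ln `|q - sin t|).
  rewrite -real_normK ?num_real// ln_div ?posrE ?exprn_gt0// lnXn//.
  by rewrite -mulr_natr; ring.
move=> h; apply: (@le_trans _ _ (1 + 2 *
    \sum_(0 <= j < N) \1_(near_sin q j) t)%:E).
  by rewrite lee_fin; have := ln2_le1; lra.
rewrite EFinD leeD// EFinM lee_pmul2l// -sumEFin.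
by apply: nneseries_lim_ge => *; rewrite lee_fin indicE.
Qed.

Lemma log_majorant_sin t : log_majorant (sin t) t = +oo%E.
Proof.
rewrite /log_majorant.
suff -> : (\sum_(0 <= j <oo) (\1_(near_sin (sin t) j) t : R)%:E = +oo)%E.
  by rewrite gt0_muley// addey.
apply: eq_infty => x; have [N xN] : exists N : nat, x <= N%:R.
  by exists (Num.truncn `|x|).+1; rewrite (le_trans (ler_norm x))// ltW// truncnS_gt.
apply: le_trans (nneseries_lim_ge N _) => [|*]; last by rewrite lee_fin indicE.
rewrite sumEFin lee_fin (le_trans xN)// -[X in X%:R]card_ord -sum1_card.
rewrite natr_sum big_mkord ler_sum// => i _.
by rewrite indicE mem_set//= /near_sin/= subrr normr0 exprn_ge0.
Qed.

End log_sine.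

(** * Bounding a growing mass by the decay of the profile that it drives *)

(** The functions m and U model the mass of balls and the profile of a radial
    solution.  As a function of ln r, the logarithm of the weight r^k e^(N U) has
    mean slope at most k - N d m / ln 4 between r and 4 r, which decreases as the
    mass accumulates.  A large weight forces a large mass just inside, hence a
    still larger weight further inside, which cannot go on: the weights are
    bounded.  Once the mass passes a threshold the weights decay geometrically,
    and with them the masses of the successive shells. *)
Section radial_mass.
Context (R : realType).
Variables (m U : R -> R) (N d c E Lam : R).
Hypotheses (N0 : 0 < N) (d0 : 0 < d) (c0 : 0 < c) (E0 : 0 <= E).
Hypothesis mLam : forall r, m r <= Lam.
Hypothesis U_drop : forall r, 0 < r -> U (4 * r) <= U r - d * m r.

Definition weight (k r : R) : R := r `^ k * expR (N * U r).

Lemma weight_gt0 k r : 0 < r -> 0 < weight k r.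
Proof. by move=> r0; rewrite mulr_gt0 ?powR_gt0 ?expR_gt0. Qed.

Lemma weight_drop k r : 0 < r ->
  weight k (4 * r) <= 4 `^ k * expR (- (N * d * m r)) * weight k r.
Proof.
move=> r0; rewrite /weight powRM ?(ltW r0)// -!mulrA ler_wpM2l ?powR_ge0//.
rewrite [leRHS]mulrCA.
rewrite ler_wpM2l ?powR_ge0// -expRD ler_expR.
rewrite -mulrN -mulrDr ler_wpM2l ?(ltW N0)//; have := U_drop r0; lra.
Qed.

Lemma geometric_bounded (a b : R) : 0 < a -> (forall i, a <= 2^-1 ^+ i * b) -> False.
Proof.
move=> a0 h.
have cv : (fun i => (2^-1 : R) ^+ i * b) @ \oo --> (0 * b : R).
  by apply: cvgM; [apply: cvg_expr; rewrite ger0_norm//; lra|exact: cvg_cst].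
rewrite mul0r in cv.
have : a <= limn (fun i => (2^-1 : R) ^+ i * b).
  by apply: limr_ge; [exact: cvgP cv|exact: nearW].
by rewrite (cvg_lim _ cv)// leNgt a0.
Qed.

(** At this level, 4^k exp (- N d c weight) = 1 / 2. *)
Definition weight_cap k := (ln 2 + k * ln 4) / (N * d * c).

Lemma ln2_gt0 : 0 < ln 2 :> R. Proof. by rewrite ln_gt0//; lra. Qed.
Lemma ln4_gt0 : 0 < ln 4 :> R. Proof. by rewrite ln_gt0//; lra. Qed.

(** Above the cap, passing from r to r / 4 at least doubles the weight, so that
    iterating contradicts the a priori bound weight <= Lam / c, however large
    Lam is. *)
Lemma weight_bounded k : 0 < k ->
  (forall r, 0 < r -> c * weight k r <= m (r / 4)) ->
  forall r, 0 < r -> weight k r <= weight_cap k.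
Proof.
move=> k0 m_low r r0; rewrite leNgt; apply/negP => big.
have p0 : 0 < N * d * c by rewrite !mulr_gt0.
have cap0 : 0 < weight_cap k.
  by rewrite divr_gt0// addr_gt0 ?mulr_gt0 ?ln2_gt0 ?ln4_gt0.
have dbl s : 0 < s -> weight_cap k < weight k s ->
    2 * weight k s <= weight k (s / 4).
  move=> s0 bs; have s40 : 0 < s / 4 by rewrite divr_gt0.
  have := weight_drop k s40; rewrite (_ : 4 * (s / 4) = s); last by field.
  have wpos := weight_gt0 k s40.
  have : 4 `^ k * expR (- (N * d * m (s / 4))) <= 2^-1.
    rewrite /powR (gt_eqF (_ : 0 < 4))// -expRD -[leRHS]lnK ?posrE//.
    rewrite ler_expR lnV ?posrE// lerBlDr addrC -lerBlDr opprK.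
    apply: (@le_trans _ _ (N * d * (c * weight k s))).
      by move: bs; rewrite /weight_cap ltr_pdivrMr//; lra.
    by rewrite ler_wpM2l ?m_low// mulr_ge0 ?ltW.
  nra.
have iter i : 2 ^+ i * weight k r <= weight k (r * 4^-1 ^+ i) /\
     weight_cap k < weight k (r * 4^-1 ^+ i).
  elim: i => [|i [IH1 IH2]]; first by rewrite !expr0 mul1r mulr1.
  have ri : 0 < r * 4^-1 ^+ i by rewrite mulr_gt0// exprn_gt0.
  have := dbl _ ri IH2.
  rewrite (_ : r * 4^-1 ^+ i / 4 = r * 4^-1 ^+ i.+1); last first.
    by rewrite exprSr mulrA.
  by rewrite (exprS 2); split; lra.
apply: (@geometric_bounded (weight k r) (Lam / c)) => [|i].
  exact: weight_gt0.
have ri : 0 < r * 4^-1 ^+ i by rewrite mulr_gt0// exprn_gt0.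
rewrite exprVn mulrC ler_pdivlMr ?exprn_gt0// mulrC.
apply: le_trans (iter i).1 _; rewrite ler_pdivlMr// mulrC.
by apply: le_trans (m_low _ ri) _.
Qed.

Variables (k0 k1 : R).
Hypotheses (k00 : 0 < k0) (k10 : 0 < k1).
Hypothesis m_low0 : forall r, 0 < r -> c * weight k0 r <= m (r / 4).
Hypothesis m_low1 : forall r, 0 < r -> c * weight k1 r <= m (r / 4).
Hypothesis m_up : forall r, 0 < r ->
  m (4 * r) - m r <= E * (weight k0 r + weight k1 r).

(** Beyond this mass both weights are at least halved from r to 4 r. *)
Definition mass_threshold := (ln 2 + (k0 + k1) * ln 4) / (N * d).

Definition mass_cap := mass_threshold + 3 * E * (weight_cap k0 + weight_cap k1).

Let G r := weight k0 r + weight k1 r.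

Lemma weights_halve r : 0 < r -> mass_threshold <= m r -> 2 * G (4 * r) <= G r.
Proof.
move=> r0 mr.
have halvek k : 0 < k -> k <= k0 + k1 -> 2 * weight k (4 * r) <= weight k r.
  move=> kp kle; have := weight_drop k r0; have wpos := weight_gt0 k r0.
  have : 4 `^ k * expR (- (N * d * m r)) <= 2^-1.
    rewrite /powR (gt_eqF (_ : 0 < 4))// -expRD -[leRHS]lnK ?posrE//.
    rewrite ler_expR lnV ?posrE// lerBlDr addrC -lerBlDr opprK.
    have : k * ln 4 <= (k0 + k1) * ln 4 by rewrite ler_wpM2r// ltW// ln4_gt0.
    move: mr; rewrite /mass_threshold ler_pdivrMr ?mulr_gt0//; lra.
  nra.
have k0le : k0 <= k0 + k1 by rewrite lerDl ltW.
have k1le : k1 <= k0 + k1 by rewrite lerDr ltW.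
have := halvek _ k00 k0le; have := halvek _ k10 k1le.
rewrite /G; lra.
Qed.

(** While m is above the threshold, m r + 2 E G r does not increase from r to 4 r,
    since a shell of mass at most E G r is paid for by the halving of G.  Below
    the threshold one step leads to at most [mass_cap].  The induction starts at
    a small radius where m is below the threshold; one exists, for otherwise
    the bounded weights would double indefinitely towards the origin. *)
Lemma radial_mass_bound r : 0 < r -> m r <= mass_cap.
Proof.
have Gle s : 0 < s -> G s <= weight_cap k0 + weight_cap k1.
  by move=> s0; apply: lerD; exact: weight_bounded.
have Gpos s : 0 < s -> 0 < G s by move=> s0; rewrite addr_gt0// weight_gt0.
move=> r0; have ri i : 0 < r * 4^-1 ^+ i by rewrite mulr_gt0// exprn_gt0.
have r4 i : r * 4^-1 ^+ i = 4 * (r * 4^-1 ^+ i.+1).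
  by rewrite exprS; field.
pose Phi s := m s + 2 * E * G s.
have step s : 0 < s -> Phi s <= mass_cap -> Phi (4 * s) <= mass_cap.
  move=> s0 h; have s40 : 0 < 4 * s by rewrite mulr_gt0.
  have up := m_up s0; rewrite -/(G s) in up.
  have [ms|/ltW ms] := leP mass_threshold (m s).
    have := ler_wpM2l E0 (weights_halve s0 ms); move: h up; rewrite /Phi; lra.
  have := ler_wpM2l E0 (Gle _ s0); have := ler_wpM2l E0 (Gle _ s40).
  by move: up ms; rewrite /Phi /mass_cap; lra.
have [i mi] : exists i, m (r * 4^-1 ^+ i) < mass_threshold.
  apply: contrapT => /forallNP small.
  apply: (@geometric_bounded (G r) (weight_cap k0 + weight_cap k1)) => [|i].
    exact: Gpos.
  (* Small radii with mass above the threshold: G doubles at each step inwards. *)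
  suff : G r <= 2^-1 ^+ i * G (r * 4^-1 ^+ i).
    move/le_trans; apply; rewrite ler_wpM2l ?exprn_ge0//; exact: Gle.
  elim: i => [|i IH]; first by rewrite !expr0 mul1r mulr1.
  apply: (le_trans IH); rewrite exprSr -mulrA ler_wpM2l ?exprn_ge0//.
  have /negP := small i.+1; rewrite -leNgt => /(weights_halve (ri i.+1)).
  by rewrite -r4; lra.
suff : Phi r <= mass_cap.
  apply: le_trans; rewrite lerDl mulr_ge0 ?mulr_ge0// ltW//; exact: Gpos.
have : Phi (r * 4^-1 ^+ i) <= mass_cap.
  have := ler_wpM2l E0 (Gle _ (ri i)); have := ler_wpM2l E0 (ltW (Gpos _ (ri i))).
  by move: mi; rewrite /Phi /mass_cap; lra.
elim: i {mi} => [|i IH]; first by rewrite expr0 mulr1.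
by move=> /(step _ (ri i.+1)); rewrite -r4.
Qed.

End radial_mass.

(** * Euclidean norm, balls and cubes *)

Section euclidean_geometry.
Context (R : realType).

Lemma measurable_enorm_comp d (T : measurableType d) n (f : T -> Rn R n) :
  (forall i, measurable_fun setT (fun t => tnth (f t) i : R)) ->
  measurable_fun setT (fun t => enorm (f t)).
Proof.
move=> mf; have ms : measurable_fun setT (@Num.sqrt R).
  by apply: continuous_measurable_fun; exact: sqrt_continuous.
apply: (measurableT_comp ms).
by apply: measurable_sum => i; apply: measurable_funX; exact: mf.
Qed.

Lemma measurable_enorm n : measurable_fun setT (@enorm R n).
Proof. by apply: measurable_enorm_comp => i; exact: measurable_tnth. Qed.

Lemma enorm_ge0 n (x : Rn R n) : 0 <= enorm x.
Proof. exact: sqrtr_ge0. Qed.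

Lemma enorm_sqr n (x : Rn R n) : enorm x ^+ 2 = \sum_(i < n) (tnth x i : R) ^+ 2.
Proof. by rewrite sqr_sqrtr// sumr_ge0// => i _; exact: sqr_ge0. Qed.

Lemma enorm_vscale n (r : R) (x : Rn R n) : enorm (vscale r x) = `|r| * enorm x.
Proof.
rewrite /enorm -sqrtr_sqr -sqrtrM ?sqr_ge0//; congr Num.sqrt.
by rewrite mulr_sumr; apply: eq_bigr => i _; rewrite tnth_mktuple exprMn.
Qed.

Lemma coord_le_enorm n (x : Rn R n) i : `|tnth x i : R| <= enorm x.
Proof.
rewrite -(ler_pXn2r (_ : 0 < 2)%N) ?nnegrE ?enorm_ge0// real_normK ?num_real//.
rewrite enorm_sqr (bigD1 i)//= lerDl sumr_ge0// => j _; exact: sqr_ge0.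
Qed.

Definition box (n : nat) (a b : R) : set (Rn R n) :=
  [set x | forall i, (tnth x i : R) \in `]a, b[].

Arguments box n : clear implicits.

Lemma box_bigcap n a b :
  box n a b = \bigcap_(i in setT) ((@tnth n (measurableTypeR R))^~ i @^-1` `]a, b[).
Proof. by apply/seteqP; split=> [x H i _|x H i]; [exact: H|exact: (H i I)]. Qed.

Lemma measurable_box n a b : measurable (box n a b).
Proof.
rewrite box_bigcap; apply: fin_bigcap_measurable => // i _.
by rewrite -[X in measurable X]setTI; apply: measurable_tnth => //.
Qed.

Lemma volume_box n a b : a <= b -> lebesgue_Rn R n (box n a b) = ((b - a) ^+ n)%:E.
Proof.
move=> ab; rewrite (@lebesgue_Rn_box R n (fun=> [set` `]a, b[]))//.
rewrite -[X in _ ^+ X]card_ord -prodr_const -prodEFin; apply: eq_bigr => i _.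
rewrite lebesgue_measure_itv/= lte_fin -EFinD; case: ltP => // ba.
by have -> : b = a by [apply/eqP; rewrite eq_le ba|]; rewrite subrr.
Qed.

Lemma measurable_oball n r : measurable (@oball R n r).
Proof.
rewrite /oball -[X in measurable X]setTI.
by apply: measurable_fun_ltr => //; exact: measurable_enorm.
Qed.

Lemma oball_sub_box n r : @oball R n r `<=` box n (- r) r.
Proof.
move=> x xr i; rewrite in_itv/= -ltr_norml.
exact: le_lt_trans (coord_le_enorm x i) xr.
Qed.

Lemma volume_oball_le n r : 0 <= r ->
  (lebesgue_Rn R n (oball r) <= ((2 * r) ^+ n)%:E)%E.
Proof.
move=> r0; have -> : 2 * r = r - - r by ring.
rewrite -volume_box; last by lra.
apply: le_measure; rewrite ?inE; [exact: measurable_oball|exact: measurable_box|].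
exact: oball_sub_box.
Qed.

(** For n >= 2 this cube lies in the ball of radius r, away from the origin; it
    replaces a spherical shell in lower bounds, its volume being immediate. *)
Definition shell_cube (n : nat) (r : R) := box n (r / (2 * n%:R)) (r / n%:R).

Arguments shell_cube n : clear implicits.

Lemma volume_shell_cube n r : (0 < n)%N -> 0 <= r ->
  lebesgue_Rn R n (shell_cube n r) = ((r / (2 * n%:R)) ^+ n)%:E.
Proof.
move=> n0 r0; have nR : 0 < n%:R :> R by rewrite ltr0n.
rewrite volume_box; last by rewrite ler_wpM2l// lef_pV2 ?posrE; lra.
by congr ((_ ^+ _)%:E); field; lra.
Qed.

Lemma shell_cube_enorm n r x : (2 <= n)%N -> 0 < r -> shell_cube n r x ->
  r / (2 * n%:R) < enorm x < r.
Proof.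
move=> n2 r0 xQ; have n0 : (0 < n)%N by exact: leq_trans n2.
have nR : 2 <= n%:R :> R by rewrite ler_nat.
have a0 : 0 < r / (2 * n%:R) by rewrite divr_gt0// mulr_gt0//; lra.
apply/andP; split.
  apply: lt_le_trans (coord_le_enorm x (Ordinal n0)).
  have := xQ (Ordinal n0); rewrite in_itv/= => /andP[h _].
  by rewrite (lt_le_trans h)// ler_norm.
rewrite -(ltr_pXn2r (_ : 0 < 2)%N) ?nnegrE ?enorm_ge0 ?(ltW r0)// enorm_sqr.
apply: (@le_lt_trans _ _ (\sum_(i < n) (r / n%:R) ^+ 2)).
  apply: ler_sum => i _; have := xQ i; rewrite in_itv/= => /andP[h1 h2].
  have h0 := lt_trans a0 h1.
  by rewrite lerXn2r ?nnegrE ?(ltW h0) ?(ltW h2)// (ltW (lt_trans h0 h2)).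
rewrite sumr_const card_ord -[X in X < _]mulr_natr.
rewrite (_ : (r / n%:R) ^+ 2 * n%:R = r ^+ 2 / n%:R); last by field; lra.
by rewrite ltr_pdivrMr ?ltr_pMr ?exprn_gt0; lra.
Qed.

Lemma measurable_punctured_ball n :
  measurable [set y : Rn R n | 0 < enorm y <= 1].
Proof.
rewrite (_ : [set _ | _] = [set y : Rn R n | 0 < enorm y] `&`
  [set y : Rn R n | enorm y <= 1]); last first.
  by apply/seteqP; split => y /= => [/andP[]//|[-> ->]].
apply: measurableI; rewrite -[X in measurable X]setTI.
  by apply: measurable_fun_ltr => //; exact: measurable_enorm.
by apply: measurable_fun_ler => //; exact: measurable_enorm.
Qed.

(** Used to show that gamma_n is positive: the punctured unit ball contains a
    cube and lies in a box. *)
Lemma cone_usphere n :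
  [set y : Rn R n | exists (r : R) x,
    [/\ (0 < r <= 1)%R, usphere x & y = vscale r x]] =
  [set y | 0 < enorm y <= 1].
Proof.
apply/seteqP; split => [y [r [x [/andP[r0 r1] x1 ->]]]|y /= /andP[y0 y1]].
  by rewrite /= enorm_vscale gtr0_norm// x1 mulr1 r0.
exists (enorm y), (vscale (enorm y)^-1 y); split; first by rewrite y0.
  by rewrite /usphere/= enorm_vscale ger0_norm ?invr_ge0 ?enorm_ge0// mulVf// gt_eqF.
apply: eq_from_tnth => i; rewrite !tnth_mktuple mulrA mulfV ?mul1r//.
by rewrite gt_eqF.
Qed.

Lemma gamma_const_gt0 n : (0 < n)%N -> 0 < gamma_const R n.
Proof.
move=> n0; rewrite /gamma_const; apply: mulr_gt0.
  by apply: divr_gt0 => //; rewrite ltr0n fact_gt0.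
rewrite fine_gt0// /surface_measure cone_usphere.
set V := lebesgue_Rn _ _ _.
have Vlo : (0 < V)%E.
  apply: (@lt_le_trans _ _ (lebesgue_Rn R n.+1 (shell_cube n.+1 1))).
    by rewrite volume_shell_cube// lte_fin exprn_gt0// divr_gt0// mulr_gt0.
  apply: le_measure; rewrite ?inE;
    [exact: measurable_box|exact: measurable_punctured_ball|].
  move=> x xQ; have /andP[h1 h2] := shell_cube_enorm (n0 : 1 < n.+1)%N ltr01 xQ.
  by rewrite /= (ltW h2) andbT (le_lt_trans _ h1)// divr_ge0// mulr_ge0.
have Vup : (V < +oo)%E.
  apply: (@le_lt_trans _ _ (((2 * 2 : R) ^+ n.+1)%:E)%E); last exact: ltry.
  apply: le_trans (volume_oball_le _ (_ : 0 <= 2)) => //.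
  apply: le_measure; rewrite ?inE;
    [exact: measurable_punctured_ball|exact: measurable_oball|].
  by move=> x /= /andP[_ x1]; rewrite /oball/=; lra.
rewrite mule_gt0//= lte_mul_pinfty//; exact: ltW.
Qed.

End euclidean_geometry.

(** * Circles centred at the origin in a coordinate plane *)

Section planar_circle.
Context (R : realType) (n : nat) (i0 i1 : 'I_n) (i01 : i0 != i1).
Implicit Types (r s t : R) (y : Rn R n).

Definition circle_pt r t : Rn R n :=
  [tuple if i == i0 then r * cos t else if i == i1 then r * sin t else 0 | i < n].

Definition dist_coef r y : R * R * R :=
  (r ^+ 2 + enorm y ^+ 2, 2 * r * (tnth y i0 : R), 2 * r * (tnth y i1 : R)).

Lemma sum_two (F : 'I_n -> R) : (forall i, i != i0 -> i != i1 -> F i = 0) ->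
  \sum_i F i = F i0 + F i1.
Proof.
move=> F0; rewrite (bigD1 i0)//= (bigD1 i1)/=; last by rewrite eq_sym.
by rewrite big1 ?addr0// => i /andP[]; exact: F0.
Qed.

Lemma enorm_circle_pt r t : 0 <= r -> enorm (circle_pt r t) = r.
Proof.
move=> r0; apply/eqP; rewrite -(eqrXn2 (_ : 0 < 2)%N) ?enorm_ge0// enorm_sqr.
rewrite sum_two => [|i /negbTE n0 /negbTE n1]; last first.
  by rewrite tnth_mktuple n0 n1 expr0n.
rewrite !tnth_mktuple eqxx (negbTE (_ : i1 != i0)) 1?eq_sym// eqxx.
by rewrite !exprMn -mulrDr cos2Dsin2 mulr1.
Qed.

Lemma sqdist_circle_pt r t y : 0 <= r ->
  enorm (vsub (circle_pt r t) y) ^+ 2 = trig_poly (dist_coef r y) t.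
Proof.
move=> r0; rewrite enorm_sqr.
transitivity (\sum_(i < n) (tnth (circle_pt r t) i : R) ^+ 2
   + \sum_(i < n) (tnth y i : R) ^+ 2
   - 2 * \sum_(i < n) (tnth (circle_pt r t) i : R) * tnth y i).
  rewrite mulr_sumr -big_split -sumrB; apply: eq_bigr => i _.
  by rewrite /vsub tnth_mktuple /=; ring.
rewrite -!enorm_sqr enorm_circle_pt//.
rewrite (@sum_two (fun i => (tnth (circle_pt r t) i : R) * tnth y i)); last first.
  by move=> i /negbTE n0 /negbTE n1; rewrite tnth_mktuple n0 n1 mul0r.
rewrite !tnth_mktuple eqxx (negbTE (_ : i1 != i0)) 1?eq_sym// eqxx /trig_poly/=.
by ring.
Qed.

Lemma planar_le_enorm y :
  (tnth y i0 : R) ^+ 2 + (tnth y i1 : R) ^+ 2 <= enorm y ^+ 2.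
Proof.
rewrite enorm_sqr (bigD1 i0)//= (bigD1 i1)/=; last by rewrite eq_sym.
by rewrite addrA lerDl sumr_ge0// => j _; exact: sqr_ge0.
Qed.

Lemma admissible_dist_coef r y : 0 < r -> admissible (dist_coef r y).
Proof.
move=> r0; have := planar_le_enorm y; have S0 := sqr_ge0 (enorm y).
have r20 : 0 < r ^+ 2 by rewrite exprn_gt0.
rewrite /admissible /dist_coef /=; set a : R := tnth y i0; set b : R := tnth y i1.
move: S0 r20; set X := r ^+ 2; set S := enorm y ^+ 2 => S0 X0 PS.
split; first by lra.
rewrite !exprMn -/X; have := sqr_ge0 (X - S); have := ler_wpM2l (ltW X0) PS; lra.
Qed.

(** The mean of ln |x - y| over a circle |x| = r of the plane increases with r,
    for every y.  Put Z = s^2, X = r^2, S = |y|^2 and let P be the square of the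
    norm of the planar part of y; the apex h for s is the largest root of
    h^2 - 2 (Z + S) h + 4 Z P.  The polynomial for r takes at h the value
    2 (Z - X) (h - 2 P) >= 0, and h lies to the right of its vertex X + S, so that
    its largest root is at most h. *)
Lemma apex_dist_coef_le r s y : 0 < r -> r <= s ->
  apex (dist_coef r y) <= apex (dist_coef s y).
Proof.
move=> r0 rs; have s0 := lt_le_trans r0 rs.
have := (admissible_dist_coef y r0).2; have := (admissible_dist_coef y s0).2.
have := planar_le_enorm y; have := sqr_ge0 (enorm y).
have : r ^+ 2 <= s ^+ 2 by rewrite lerXn2r// nnegrE ltW.
have : 0 < r ^+ 2 by rewrite exprn_gt0.
rewrite /apex /dist_coef /= !exprMn.
set X := r ^+ 2; set Z := s ^+ 2; set S := enorm y ^+ 2.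
set a : R := tnth y i0; set b : R := tnth y i1; set P := a ^+ 2 + b ^+ 2.
move=> X0 XZ S0 PS.
rewrite -!mulrDr -/P => hZ hX.
set D := Num.sqrt ((Z + S) ^+ 2 - _).
have D0 : 0 <= D by exact: sqrtr_ge0.
have D2 : D ^+ 2 = (Z + S) ^+ 2 - 2 ^+ 2 * Z * P by rewrite sqr_sqrtr// subr_ge0.
have hP : 2 * P <= Z + S + D.
  have [|lt] := leP (2 * P) (Z + S); first by lra.
  suff : 2 * P - (Z + S) <= D by lra.
  have P0 : 0 <= P by rewrite addr_ge0 ?sqr_ge0.
  rewrite -(ler_pXn2r (_ : 0 < 2)%N) ?nnegrE//; last by lra.
  by rewrite D2; have := ler_wpM2l P0 PS; lra.
rewrite -lerBrDl -[leRHS]ger0_norm; last by lra.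
rewrite -sqrtr_sqr ler_wsqrtr//.
have H : 0 <= (Z - X) * (Z + S + D - 2 * P) by rewrite mulr_ge0//; lra.
have -> : (Z + S + D - (X + S)) ^+ 2 =
   (X + S) ^+ 2 - 2 ^+ 2 * X * P + 2 * ((Z - X) * (Z + S + D - 2 * P))
   + (D ^+ 2 - ((Z + S) ^+ 2 - 2 ^+ 2 * Z * P)) by ring.
rewrite D2; lra.
Qed.

(** A point y inside the ball of radius r is seen from the circle of radius 4 r
    at a geometric mean distance at least twice as large as from the circle of
    radius r. *)
Lemma apex_dist_coef_shell r y : 0 < r -> enorm y < r ->
  4 * apex (dist_coef r y) <= apex (dist_coef (4 * r) y).
Proof.
move=> r0 yr; have r40 : 0 < 4 * r by rewrite mulr_gt0.
have /andP[_] := apex_bounds (admissible_dist_coef y r0).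
have /andP[+ _] := apex_bounds (admissible_dist_coef y r40).
have : enorm y ^+ 2 <= r ^+ 2 by rewrite lerXn2r ?nnegrE ?enorm_ge0 ?ltW.
have := sqr_ge0 (enorm y).
rewrite /dist_coef /= exprMn; lra.
Qed.

End planar_circle.

(** * Comparing a logarithmic potential on two spheres *)

Section nonnegative_majorant.
Context d (T : measurableType d) (R : realType) (mu : {measure set T -> \bar R}).

Lemma le_integral_ge0 (f g : T -> \bar R) : mu.-integrable setT f ->
  (forall x, 0 <= g x)%E -> measurable_fun setT g -> (forall x, f x <= g x)%E ->
  (\int[mu]_x f x <= \int[mu]_x g x)%E.
Proof.
move=> intf g0 mg fg; have [->|foo] := eqVneq (\int[mu]_x g x)%E +oo%E.
  exact: leey.
apply: le_integral => //; apply/integrableP; split => //.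
under eq_integral do rewrite gee0_abs//.
by rewrite ltey.
Qed.

End nonnegative_majorant.

Section potential_comparison.
Context (R : realType) (n : nat) (i0 i1 : 'I_n) (i01 : i0 != i1).
Implicit Types (r s t : R) (y : Rn R n).

Definition log_kernel (x y : Rn R n) : R :=
  ln ((1 + enorm y) / enorm (vsub x y)).

Let pt := @circle_pt R n i0 i1.

Lemma log_kernel_circle r t y : 0 < r -> trig_poly (dist_coef i0 i1 r y) t != 0 ->
  log_kernel (pt r t) y =
  ln (1 + enorm y) + (- 2^-1) * ln (trig_poly (dist_coef i0 i1 r y) t).
Proof.
move=> r0; rewrite -(sqdist_circle_pt i01 _ _ (ltW r0)) sqrf_eq0 => d0.
have dpos : 0 < enorm (vsub (pt r t) y) by rewrite lt0r d0 enorm_ge0.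
rewrite lnXn// /log_kernel ln_div ?posrE//; last by rewrite ltr_wpDr ?enorm_ge0.
by rewrite mulr2n; field.
Qed.

Lemma measurable_log_kernel d (T : measurableType d) (f g : T -> Rn R n) :
  (forall i, measurable_fun setT (fun z => tnth (f z) i : R)) ->
  (forall i, measurable_fun setT (fun z => tnth (g z) i : R)) ->
  measurable_fun setT (fun z => log_kernel (f z) (g z)).
Proof.
move=> mf mg; rewrite /log_kernel; apply: (measurableT_comp (@measurable_ln R)).
apply: measurable_funM.
  by apply: measurable_funD => //; exact: measurable_enorm_comp.
have -> : (fun z => (enorm (vsub (f z) (g z)))^-1) =
    (fun x => x `^ (-1)) \o (fun z => enorm (vsub (f z) (g z))).
  by apply/funext => z /=; rewrite powR_inv1 ?enorm_ge0.
apply: (measurableT_comp (measurable_powR _)).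
apply: measurable_enorm_comp => i.
have -> : (fun z => tnth (vsub (f z) (g z)) i : R) =
   (fun z => (tnth (f z) i : R) - tnth (g z) i).
  by apply/funext => z; rewrite tnth_mktuple.
exact: measurable_funB.
Qed.

Lemma measurable_log_kernel_circle r :
  measurable_fun setT (fun z : R * Rn R n => log_kernel (pt r z.1) z.2).
Proof.
have mc : measurable_fun setT (@cos R).
  by apply: continuous_measurable_fun; exact: continuous_cos.
have ms : measurable_fun setT (@sin R).
  by apply: continuous_measurable_fun; exact: continuous_sin.
apply: measurable_log_kernel => i; last first.
  exact: (measurableT_comp (measurable_tnth i) measurable_snd).
have -> : (fun z : R * Rn R n => tnth (pt r z.1) i : R) =
    (fun z : R * Rn R n =>
     if i == i0 then r * cos z.1 else if i == i1 then r * sin z.1 else 0).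
  by apply/funext => z; rewrite tnth_mktuple.
case: (i == i0); [|case: (i == i1) => //].
  by apply: measurable_funM => //; exact: (measurableT_comp mc).
by apply: measurable_funM => //; exact: (measurableT_comp ms).
Qed.

#[local] Arguments iter : simpl never.

Definition circle_mean k r t y :=
  iter k (@half_angle_mean R) (fun s => log_kernel (pt r s) y) t.

Lemma circle_meanS k r t y : circle_mean k.+1 r t y =
  2^-1 * (circle_mean k r (t / 2) y + circle_mean k r (t / 2 + pi) y).
Proof. by rewrite /circle_mean iterS /half_angle_mean mulrC. Qed.

Lemma measurable_circle_mean k r :
  measurable_fun setT (fun z : R * Rn R n => circle_mean k r z.1 z.2).
Proof.
elim: k => [|k IH]; first exact: measurable_log_kernel_circle.
under eq_fun do rewrite circle_meanS.
have m2 : measurable_fun setT (fun z : R * Rn R n => z.1 / 2).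
  by apply: measurable_funM.
apply: measurable_funM => //; apply: measurable_funD.
  apply: (measurableT_comp IH (measurable_fun_pair m2 measurable_snd)).
apply: (measurableT_comp IH (measurable_fun_pair _ measurable_snd)).
exact: measurable_funD.
Qed.

Variable K : Rn R n -> R.
Hypothesis K0 : forall y, 0 <= K y.
Let mu := lebesgue_Rn R n.
Hypothesis intK : mu.-integrable setT (EFin \o K).

Definition potential_on_sphere r (V : R) := forall x, enorm x = r ->
  mu.-integrable setT (EFin \o (fun y => log_kernel x y * K y)) /\
  (\int[mu]_y (log_kernel x y * K y)%:E = V%:E)%E.

(** The potential is constant on the sphere, hence equal to its average over any
    finite set of points of the sphere. *)
Lemma circle_mean_potential k r V t : 0 <= r -> potential_on_sphere r V ->
  mu.-integrable setT (EFin \o (fun y => circle_mean k r t y * K y)) /\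
  (\int[mu]_y (circle_mean k r t y * K y)%:E = V%:E)%E.
Proof.
move=> r0 pot; elim: k t => [|k IH] t.
  by apply: pot; exact: enorm_circle_pt.
have [i1' e1] := IH (t / 2); have [i2' e2] := IH (t / 2 + pi).
pose g u y : R := circle_mean k r u y * K y.
have E : EFin \o (fun y => circle_mean k.+1 r t y * K y) =
   (fun y => (2^-1)%:E * ((EFin \o g (t / 2)%R) \+ (EFin \o g (t / 2 + pi)%R)) y)%E.
  by apply/funext => y; rewrite /comp circle_meanS -mulrA mulrDl EFinM EFinD.
have I := integrableD measurableT i1' i2'; split.
  by rewrite E; exact: integrableZl.
have -> : (\int[mu]_y (circle_mean k.+1 r t y * K y)%:E =
  \int[mu]_y (EFin \o (fun y => (circle_mean k.+1 r t y * K y)%R)) y)%E by [].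
rewrite E (integralZl measurableT I) (integralD measurableT i1' i2')/= e1 e2.
by rewrite -EFinD -EFinM; congr EFin; field.
Qed.

(** If delta is below the limit of the difference of two polygon means, its excess
    over that difference is O(2^-k) with constants integrable in t.  The excess
    itself is used as the error so that the limit, as a function of y, never has
    to be integrated. *)
Lemma circle_mean_error k r s delta y : 0 < r -> 0 < s ->
  delta <= 2^-1 * (ln (apex (dist_coef i0 i1 s y) / 2) -
                   ln (apex (dist_coef i0 i1 r y) / 2)) ->
  exists p q : R, forall t,
  ((Num.max 0 (delta + circle_mean k s t y - circle_mean k r t y))%:E <=
  (2^-1 ^+ k)%:E * (2%:E + (log_majorant p t + log_majorant q t)))%E.
Proof.
move=> r0 s0 dle.
have [p hp] := iter_half_angle_mean_ln_bounds k (admissible_dist_coef i01 y s0).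
have [q hq] := iter_half_angle_mean_ln_bounds k (admissible_dist_coef i01 y r0).
exists p, q => t; have k0 : 0 < 2^-1 ^+ k :> R by rewrite exprn_gt0.
have [->|pt'] := eqVneq p (sin t).
  rewrite log_majorant_sin addye ?gt_eqF ?(lt_le_trans _ (log_majorant_ge0 _ _))//.
  by rewrite addey// gt0_muley ?leey// lte_fin.
have [->|qt'] := eqVneq q (sin t).
  rewrite log_majorant_sin addey ?gt_eqF ?(lt_le_trans _ (log_majorant_ge0 _ _))//.
  by rewrite addey// gt0_muley ?leey// lte_fin.
have [|ds Es /andP[ds1 ds2]] := hp _ _ _ t (fun u => @log_kernel_circle s u y s0).
  by rewrite eq_sym.
have [|dr Er /andP[dr1 dr2]] := hq _ _ _ t (fun u => @log_kernel_circle r u y r0).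
  by rewrite eq_sym.
have ln4 : ln 4 <= 2 :> R.
  rewrite (_ : 4 = 2 ^+ 2); last by rewrite -natrX.
  by rewrite lnXn// mulr2n; have := ln2_le1 R; lra.
apply: (@le_trans _ _ ((2^-1 ^+ k)%:E * (2%:E + (- ln ((p - sin t) ^+ 2 / 2))%:E))%E).
  rewrite -EFinD -EFinM lee_fin ge_max.
  have lnp : 0 <= 2 - ln ((p - sin t) ^+ 2 / 2) by lra.
  rewrite mulr_ge0 ?(ltW k0)//= /circle_mean Es Er.
  have h : (dr - ds) / 2 <= 2 - ln ((p - sin t) ^+ 2 / 2) by lra.
  have := ler_wpM2l (ltW k0) h; rewrite -!exprVn. lra.
rewrite lee_pmul2l// leeD2l// (le_trans (log_majorantP pt'))//.
by rewrite leeDl// log_majorant_ge0.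
Qed.

(** For fixed k and t the inequality holds up to the integral of the error at t.
    This integral cannot be bounded for a given t, as K is arbitrary near the
    vertices of the polygon; but the inequality does not depend on t, so it may
    be averaged over 0 <= t <= 1, and by Tonelli's theorem the averaged error is
    O(2^-k) times the integral of K. *)
Lemma potential_compare r s Vr Vs (delta : Rn R n -> R) : 0 < r -> 0 < s ->
  potential_on_sphere r Vr -> potential_on_sphere s Vs ->
  measurable_fun setT delta ->
  mu.-integrable setT (EFin \o (fun y => delta y * K y)) ->
  (forall y, delta y <= 2^-1 * (ln (apex (dist_coef i0 i1 s y) / 2) -
                   ln (apex (dist_coef i0 i1 r y) / 2))) ->
  (\int[mu]_y (delta y * K y)%:E <= (Vr - Vs)%:E)%E.
Proof.
move=> r0 s0 potr pots mdelta idelta dle.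
have mK : measurable_fun setT K by apply/measurable_EFinP; exact: measurable_int intK.
pose C : R := 2 + 2 * (1 + 2 * (8 / cos 1)).
have C0 : 0 <= C.
  have : 0 <= 8 / cos 1 :> R by rewrite divr_ge0// ltW// cos1_gt0.
  by rewrite /C; lra.
pose err k t y := Num.max 0 (delta y + circle_mean k s t y - circle_mean k r t y).
have merr k : measurable_fun setT (fun z : R * Rn R n => err k z.1 z.2).
  apply: measurable_maxr => //; apply: measurable_funB.
    apply: measurable_funD; last exact: measurable_circle_mean.
    exact: (measurableT_comp mdelta measurable_snd).
  exact: measurable_circle_mean.
have merr1 k t : measurable_fun setT (err k t).
  exact: (measurableT_comp (merr k) (measurable_fun_pair (measurable_cst t)
    (@measurable_id _ _ setT))).
have merr2 k y : measurable_fun setT (fun t : measurableTypeR R => err k t y).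
  exact: (measurableT_comp (merr k) (measurable_fun_pair (@measurable_id _ _ setT)
    (measurable_cst y))).
have err0 k t y : 0 <= err k t y by rewrite le_max lexx.
have [D ED] : exists D : R, (\int[mu]_y (delta y * K y)%:E = D%:E)%E.
  by have /fineK <- := integrable_fin_num measurableT idelta; eexists.
have [L EL] : exists L : R, (\int[mu]_y (K y)%:E = L%:E)%E.
  by have /fineK <- := integrable_fin_num measurableT intK; eexists.
rewrite ED lee_fin.
have lower k t : ((D + Vs - Vr)%:E <= \int[mu]_y (err k t y * K y)%:E)%E.
  have [is_ es] := circle_mean_potential k t (ltW s0) pots.
  have [ir er] := circle_mean_potential k t (ltW r0) potr.
  have id_ := integrableD measurableT idelta is_.
  have -> : ((D + Vs - Vr)%:E = \int[mu]_y
      (((delta y * K y)%:E + (circle_mean k s t y * K y)%:E)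
      - (circle_mean k r t y * K y)%:E))%E.
    by rewrite integralB// integralD// [in RHS]/= ED es er.
  have mI : measurable_fun setT (fun y => err k t y * K y).
    exact: measurable_funM.
  apply: le_integral_ge0; first exact: integrableB.
  - by move=> y; rewrite lee_fin mulr_ge0.
  - exact/measurable_EFinP.
  move=> y; rewrite -[leLHS]/((delta y * K y + circle_mean k s t y * K y
    - circle_mean k r t y * K y)%:E) lee_fin -mulrDl -mulrBl.
  by rewrite ler_wpM2r// le_max lexx orbT.
have [|X0] := leP (D + Vs - Vr) 0; first by lra.
have upper k : ((D + Vs - Vr)%:E <= (2^-1 ^+ k * (C * L))%:E)%E.
  pose f (z : measurableTypeR R * Rn R n) : \bar R :=
    ((err k z.1 z.2 * K z.2) * \1_(`[0%R, 1%R]%classic : set R) z.1)%:E.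
  have m01 : measurable_fun setT
    (\1_(`[0%R, 1%R]%classic : set (measurableTypeR R)) : measurableTypeR R -> R).
    exact: measurable_indic.
  have mf : measurable_fun setT f.
    apply/measurable_EFinP; apply: measurable_funM.
      apply: measurable_funM; first exact: merr.
      exact: (measurableT_comp mK measurable_snd).
    exact: (measurableT_comp m01 measurable_fst).
  have f0 z : (0 <= f z)%E by rewrite lee_fin !mulr_ge0.
  have tonelli := @fubini_tonelli _ _ _ _ R (@lebesgue_measure R) mu f mf f0.
  (* The left-hand side is its own average over 0 <= t <= 1. *)
  apply: (@le_trans _ _ (\int[lebesgue_measure]_t \int[mu]_y f (t, y))%E).
    rewrite -[leLHS]mule1.
    have <- : (\int[lebesgue_measure]_t (\1_(`[0%R, 1%R]%classic : set R) t)%:E)%E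
        = 1%E :> \bar R.
      rewrite integral_indic// setIT.
      by rewrite [LHS](lebesgue_measure_itv `[0%R, 1%R])/= lte01 oppr0 adde0.
    rewrite -integralZl//; last first.
      exact: (integrable_indic_itv 0 1 true false).
    apply: ge0_le_integral => //.
    - by move=> t _; rewrite -EFinM lee_fin mulr_ge0 ?(ltW X0).
    - apply: measurable_funeM; apply/measurable_EFinP.
      exact: measurable_indic.
    - exact: measurable_fun_fubini_tonelli_F.
    move=> t _; rewrite /f /=; under eq_integral do rewrite EFinM muleC.
    rewrite ge0_integralZl//; last 2 first.
    - apply/measurable_EFinP; exact: measurable_funM.
    - by move=> y _; rewrite lee_fin mulr_ge0.
    by rewrite muleC lee_wpmul2l ?lee_fin//; exact: lower.
  rewrite tonelli.
  apply: (@le_trans _ _ (\int[mu]_y ((2^-1 ^+ k * C)%:E * (K y)%:E))%E).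
    apply: ge0_le_integral => //.
    - by move=> y _; exact: integral_ge0.
    - exact: measurable_fun_fubini_tonelli_G.
    - by apply: measurable_funeM; exact: measurable_int intK.
    move=> y _; have [p [q pq]] := circle_mean_error k r0 s0 (dle y).
    rewrite /f /=.
    under eq_integral do rewrite mulrAC EFinM muleC.
    rewrite ge0_integralZl//; last 3 first.
    - apply/measurable_EFinP; apply: measurable_funM; last exact: measurable_indic.
      exact: (merr2 k y).
    - by move=> t _; rewrite lee_fin mulr_ge0.
    - by rewrite lee_fin.
    rewrite muleC lee_wpmul2r ?lee_fin//.
    pose h t := ((2^-1 ^+ k)%:E * (2%:E + (log_majorant p t + log_majorant q t)))%E.
    have h0 t : (0 <= h t)%E.
      apply: mule_ge0; first by rewrite lee_fin exprn_ge0.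
      by apply: adde_ge0 => //; apply: adde_ge0; exact: log_majorant_ge0.
    have mpq : measurable_fun (setT : set (measurableTypeR R))
        (fun t => log_majorant p t + log_majorant q t)%E.
      by apply: emeasurable_funD; exact: measurable_log_majorant.
    have m2pq : measurable_fun (setT : set (measurableTypeR R))
        (fun t => 2%:E + (log_majorant p t + log_majorant q t))%E.
      by apply: emeasurable_funD => //; exact: measurable_cst.
    have mh : measurable_fun (setT : set (measurableTypeR R)) h by exact: measurable_funeM.
    apply: (@le_trans _ _ (\int[lebesgue_measure]_t (h \_ `[0%R, 1%R]) t)%E).
      apply: ge0_le_integral => //.
      - by move=> t _; rewrite lee_fin mulr_ge0.
      - apply/measurable_EFinP; apply: measurable_funM; last exact: measurable_indic.
        exact: (merr2 k y).
      - apply/(measurable_restrictT _ _).1 => //.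
        exact: (measurable_funTS mh).
      move=> t _; rewrite patchE indicE; case: ifPn => _; last by rewrite mulr0.
      by rewrite mulr1; exact: pq.
    rewrite -integral_mkcond /h ge0_integralZl//; last 2 first.
    - apply: measurable_funTS; exact: m2pq.
    - move=> t _; apply: adde_ge0 => //.
      by apply: adde_ge0; exact: log_majorant_ge0.
    rewrite EFinM lee_pmul2l ?lte_fin ?exprn_gt0//.
    have ms u : measurable_fun (`[0%R, 1%R] : set (measurableTypeR R)) (log_majorant u).
      apply: measurable_funTS; exact: measurable_log_majorant.
    rewrite ge0_integralD//; last 2 first.
    - by move=> t _; apply: adde_ge0; exact: log_majorant_ge0.
    - apply: measurable_funTS; exact: mpq.
    rewrite ge0_integralD//; last 2 first.
    - by move=> t _; rewrite log_majorant_ge0.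
    - by move=> t _; rewrite log_majorant_ge0.
    rewrite integral_cst// [X in (_ * X)%E](lebesgue_measure_itv `[0%R, 1%R])/=.
    rewrite lte01 oppr0 adde0 mule1 /C [leRHS]EFinD; apply: leeD => //.
    rewrite (_ : 2 * _ = (1 + 2 * (8 / cos 1)) + (1 + 2 * (8 / cos 1))); last by ring.
    by rewrite [leRHS]EFinD; apply: leeD; exact: integral_log_majorant.
  rewrite integralZl// EL -EFinM lee_fin mulrA //.
exfalso; apply: (@geometric_bounded R (D + Vs - Vr) (C * L)) => //.
Qed.
End potential_comparison.

(** * The profile of a radial solution *)

Section radial_profile.
Context (R : realType) (n : nat) (i0 i1 : 'I_n) (i01 : i0 != i1).
Variables (K u : Rn R n -> R) (g c : R).
Let mu := lebesgue_Rn R n.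
Hypotheses (g0 : 0 < g) (K0 : forall y, 0 <= K y).
Hypothesis intK : mu.-integrable setT (EFin \o K).
Hypothesis radu : radial u.
Hypothesis eq_u : forall x, ((u x)%:E =
  (g^-1)%:E * (\int[mu]_y (log_kernel x y * K y)%:E) + c%:E)%E.

Definition profile (r : R) : R := u (circle_pt i0 i1 r 0).

Definition ball_mass (r : R) : R := fine (\int[mu]_(y in oball r) (K y)%:E)%E.

Lemma profileE x : u x = profile (enorm x).
Proof. by apply: radu; rewrite enorm_circle_pt// enorm_ge0. Qed.

Let mK : measurable_fun setT K.
Proof. by apply/measurable_EFinP; exact: measurable_int intK. Qed.

(** As u is real-valued, the integral in the equation is finite, and a finite
    Lebesgue integral is absolutely convergent. *)
Lemma profile_potential r : potential_on_sphere K r (g * (profile r - c)).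
Proof.
move=> x xr; set I := (\int[_]_y _)%E.
have IE : (I = (g * (profile r - c))%:E)%E.
  have := eq_u x; rewrite profileE xr -/I; case: I => [v||].
  - rewrite -EFinM -EFinD => -[] ->; congr EFin; field; rewrite gt_eqF//.
  - by rewrite gt0_muley ?lte_fin ?invr_gt0//.
  - by rewrite gt0_muleNy ?lte_fin ?invr_gt0//.
split=> //; have mf : measurable_fun setT (fun y => log_kernel x y * K y).
  apply: measurable_funM => //; apply: measurable_log_kernel => i.
    exact: measurable_cst.
  exact: measurable_tnth.
apply/integrableP; split; first exact/measurable_EFinP.
by rewrite (integral_fin_num_abs mu measurableT mf) -/I IE.
Qed.

Lemma profile_noninc r s : 0 < r -> r <= s -> profile s <= profile r.
Proof.
move=> r0 rs; have s0 := lt_le_trans r0 rs.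
have := @potential_compare R n i0 i1 i01 K K0 intK r s _ _ (cst 0) r0 s0
  (@profile_potential r) (@profile_potential s).
have -> : EFin \o (fun y => cst 0 y * K y) = cst 0%E.
  by apply/funext => y /=; rewrite mul0r.
under eq_integral do rewrite /= mul0r.
rewrite integral0 lee_fin => H.
have : 0 <= g * (profile r - c) - g * (profile s - c).
  apply: H; [exact: measurable_cst|exact: integrable0|move=> y /=].
  have a0 := admissible_dist_coef i01 y r0.
  have /andP[ar _] := apex_bounds a0; case: a0 => A0 _.
  rewrite mulr_ge0// subr_ge0 ler_ln ?posrE//.
  - by rewrite ler_wpM2r// apex_dist_coef_le.
  - by rewrite divr_gt0// (lt_le_trans A0).
  - by rewrite divr_gt0// (lt_le_trans A0)// (le_trans ar)// apex_dist_coef_le.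
rewrite -mulrBr pmulr_rge0//; lra.
Qed.

Lemma integrable_ball r : mu.-integrable (oball r) (EFin \o K).
Proof. by apply: integrableS intK => //; exact: measurable_oball. Qed.

Lemma ball_massE r : (\int[mu]_(y in oball r) (K y)%:E = (ball_mass r)%:E)%E.
Proof.
rewrite /ball_mass fineK//.
exact: (integrable_fin_num (measurable_oball _) (integrable_ball r)).
Qed.

Lemma profile_drop r : 0 < r ->
  profile (4 * r) <= profile r - ln 2 / g * ball_mass r.
Proof.
move=> r0; have s0 : 0 < 4 * r by rewrite mulr_gt0.
have mi : measurable_fun setT (\1_(@oball R n r) : Rn R n -> R).
  by apply: measurable_indic; exact: measurable_oball.
(* On the ball the increase of ln a is at least ln 2, elsewhere it is at least 0. *)
pose delta (y : Rn R n) : R := ln 2 * \1_(oball r) y.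
have E : (fun y => (delta y * K y)%:E) =
    (fun y => (ln 2)%:E * ((EFin \o K) \_ (oball r)) y)%E.
  apply/funext => y; rewrite patchE /delta indicE.
  by case: ifPn => _; rewrite ?mulr1 ?mulr0 ?mul0r ?mule0 -?EFinM.
have int1 : mu.-integrable setT ((EFin \o K) \_ (oball r)).
  rewrite -integrable_mkcond; [exact: integrable_ball|exact: measurable_oball].
have := @potential_compare R n i0 i1 i01 K K0 intK r (4 * r) _ _ delta r0 s0
  (@profile_potential r) (@profile_potential (4 * r)).
rewrite E integralZl// -integral_mkcond ball_massE -EFinM lee_fin => H.
have : ln 2 * ball_mass r <= g * (profile r - c) - g * (profile (4 * r) - c).
  apply: H; first exact: measurable_funM.
    rewrite (_ : _ \o _ = (fun y => (delta y * K y)%:E))// E.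
    exact: integrableZl.
  move=> y; rewrite /delta indicE.
  have ar := admissible_dist_coef i01 y r0.
  have pr : 0 < apex (dist_coef i0 i1 r y) / 2.
    by rewrite divr_gt0// (lt_le_trans ar.1)//; case/andP: (apex_bounds ar).
  have as_ := admissible_dist_coef i01 y s0.
  have ps : 0 < apex (dist_coef i0 i1 (4 * r) y) / 2.
    by rewrite divr_gt0// (lt_le_trans as_.1)//; case/andP: (apex_bounds as_).
  have [/set_mem yr|yr] := boolP (y \in oball r); last first.
    rewrite mulr0 mulr_ge0// subr_ge0 ler_ln ?posrE//.
    by rewrite ler_wpM2r// apex_dist_coef_le//; lra.
  rewrite mulr1 -ler_pdivrMl ?invr_gt0// invrK lerBrDr.
  have -> : 2 * ln 2 = ln 4 :> R.
    by rewrite -[4]/(2 * 2)%N%:R natrM lnM ?posrE//; ring.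
  rewrite -lnM ?posrE// ler_ln ?posrE//; last exact: mulr_gt0.
  by rewrite mulrA ler_wpM2r// apex_dist_coef_shell.
rewrite -mulrBr => h.
suff : g * (ln 2 / g * ball_mass r) <= g * (profile r - profile (4 * r)).
  by rewrite ler_pM2l//; lra.
rewrite (_ : g * (ln 2 / g * _) = ln 2 * ball_mass r); last by field; rewrite gt_eqF//.
by apply: (le_trans h); rewrite ler_wpM2l ?(ltW g0)//; lra.
Qed.

End radial_profile.

(** * Mass of small cubes and of shells *)

Section power_bounds.
Context (R : realType).

(** Largest factor by which t^e changes when t is multiplied or divided by at
    most L, for an exponent e of either sign. *)
Definition distortion (e L : R) : R := expR (`|e| * ln L).

Lemma powR_distortion (e L r x : R) : 1 <= L -> 0 < r -> r / L <= x <= r * L ->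
  (distortion e L)^-1 * r `^ e <= x `^ e <= distortion e L * r `^ e.
Proof.
move=> L1 r0 /andP[x1 x2]; have L0 : 0 < L by lra.
have x0 : 0 < x by apply: lt_le_trans x1; rewrite divr_gt0.
rewrite /distortion -expRN /powR !gt_eqF// -!expRD !ler_expR.
have h1 : ln r - ln L <= ln x.
  by rewrite -ln_div ?posrE// ler_ln ?posrE// divr_gt0.
have h2 : ln x <= ln r + ln L.
  by rewrite -lnM ?posrE// ler_ln ?posrE// mulr_gt0.
have : `|e * (ln x - ln r)| <= `|e| * ln L.
  by rewrite normrM ler_wpM2l// ler_norml; lra.
rewrite ler_norml; lra.
Qed.

Lemma distortion_le (e e' L : R) : 1 <= L -> `|e| <= `|e'| ->
  distortion e L <= distortion e' L.
Proof. by move=> L1 ee; rewrite ler_expR ler_wpM2r// ln_ge0. Qed.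

Lemma distortion_gt0 (e L : R) : 0 < distortion e L.
Proof. exact: expR_gt0. Qed.

End power_bounds.

Section shell_mass.
Context (R : realType) (n : nat) (i0 i1 : 'I_n) (i01 : i0 != i1).
Variables (K u : Rn R n -> R).
Let mu := lebesgue_Rn R n.
Let N : R := n%:R.
Hypothesis n2 : (2 <= n)%N.
Hypothesis K0 : forall y, 0 <= K y.
Hypothesis intK : mu.-integrable setT (EFin \o K).
Hypothesis radu : radial u.
Let U := profile i0 i1 u.
Let m := ball_mass K.
Hypothesis U_noninc : forall r s, 0 < r -> r <= s -> U s <= U r.

Let mKE : measurable_fun setT (EFin \o K).
Proof. exact: measurable_int intK. Qed.

Let N2 : 2 <= N. Proof. by rewrite ler_nat. Qed.

Let N0 : 0 < N. Proof. exact: lt_le_trans N2. Qed.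

Let N8 : 1 <= 8 * N.
Proof.
have : 2 <= n%:R :> R by rewrite ler_nat.
rewrite /N; lra.
Qed.

Lemma weightD e k r : 0 < r -> weight U N (e + k) r = r `^ k * weight U N e r.
Proof.
move=> r0; rewrite /weight powRD; first by ring.
by rewrite (gt_eqF r0) implybT.
Qed.

(** The profile being non-increasing, u >= U r on the ball of radius r, and K has
    at least the corresponding mass on a cube in the ball of radius r / 4.  The
    smaller ball leaves room for [profile_drop] between r / 4 and r. *)
Lemma ball_mass_low e r : 0 < r ->
  (\forall x \ae mu, 0 < enorm x ->
     enorm x `^ e * expR (N * u x) <= K x) ->
  (distortion e (8 * N))^-1 / (8 * N) ^+ n * weight U N (e + N) r <= m (r / 4).
Proof.
move=> r0 Klow; have r40 : 0 < r / 4 by rewrite divr_gt0.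
have mcube : measurable (@shell_cube R n (r / 4)) by exact: measurable_box.
(* A lower bound for K on the cube, by [powR_distortion] and U r <= u. *)
pose v := (distortion e (8 * N))^-1 * r `^ e * expR (N * U r).
have v0 : 0 <= v.
  by rewrite !mulr_ge0 ?powR_ge0 ?expR_ge0// invr_ge0 ltW// distortion_gt0.
have cubeP x : @shell_cube R n (r / 4) x -> r / (8 * N) <= enorm x /\ enorm x < r / 4.
  move=> xQ; have /andP[h1 h2] := shell_cube_enorm n2 r40 xQ; split=> //.
  apply: le_trans (ltW h1); rewrite le_eqVlt; apply/orP; left; apply/eqP.
  by rewrite -/N; field; rewrite gt_eqF.
rewrite -lee_fin -ball_massE//.
apply: (@le_trans _ _ (\int[mu]_(x in @shell_cube R n (r / 4)) (K x)%:E)%E); last first.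
  apply: ge0_subset_integral => //;
    [exact: measurable_oball|exact: measurable_funTS| |].
    by move=> x _; rewrite lee_fin.
  by move=> x /cubeP[].
apply: (@le_trans _ _ (\int[mu]_(x in @shell_cube R n (r / 4)) (cst v%:E x))%E).
  have vol := volume_shell_cube (leq_trans (isT : (0 < 2)%N) n2) (ltW r40).
  rewrite integral_cst// [X in (_ * X)%E]vol.
  rewrite -EFinM lee_fin le_eqVlt; apply/orP; left; apply/eqP.
  rewrite weightD// /N powR_mulrn ?(ltW r0)// -/N /weight /v.
  have -> : r / 4 / (2 * N) = r / (8 * N) by field; rewrite gt_eqF.
  rewrite expr_div_n; field.
  by rewrite (gt_eqF (distortion_gt0 _ _)) andbT expf_neq0// mulf_neq0// gt_eqF.
apply: ae_ge0_le_integral => //.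
- by move=> x _; rewrite lee_fin.
- exact: measurable_funTS.
apply: filterS Klow => x Kx /cubeP[h1 h2]; rewrite lee_fin.
have x0 : 0 < enorm x by apply: lt_le_trans h1; rewrite divr_gt0// mulr_gt0.
apply: le_trans (Kx x0).
apply: ler_pM.
- by rewrite mulr_ge0 ?powR_ge0// invr_ge0 ltW// distortion_gt0.
- exact: expR_ge0.
- have rng : r / (8 * N) <= enorm x <= r * (8 * N).
    rewrite h1 (le_trans (ltW h2))// ler_wpM2l ?(ltW r0)//.
    by apply: le_trans N8; lra.
  by have /andP[] := powR_distortion e N8 r0 rng.
rewrite ler_expR ler_wpM2l ?(ltW N0)// (profileE i01 radu x) U_noninc//.
by rewrite (le_trans (ltW h2))//; lra.
Qed.

(** On the shell r <= |x| < 4 r one has u <= U r and |x|^e is comparable to r^e.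
    The first two terms then contribute through the volume of the shell, of order
    r^n, and the third one through the integral of h. *)
Lemma ball_mass_up e0 e1 e2 (A B : R) (h : Rn R n -> R) r : 0 < r ->
  0 <= A -> 0 <= B -> (forall x, 0 <= h x) -> measurable_fun setT h ->
  (\forall x \ae mu, 0 < enorm x ->
     K x <= (A * enorm x `^ e0 + B * enorm x `^ e1 + h x * enorm x `^ e2)
            * expR (N * u x)) ->
  forall b : R, (\int[mu]_x (h x)%:E = b%:E)%E ->
  m (4 * r) - m r <=
    8 ^+ n * (A * distortion e0 4) * weight U N (e0 + N) r
  + 8 ^+ n * (B * distortion e1 4) * weight U N (e1 + N) r
  + b * distortion e2 4 * weight U N e2 r.
Proof.
move=> r0 A0 B0 h0 mh Kup b hb; have r40 : 0 < 4 * r by rewrite mulr_gt0.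
have mo s := @measurable_oball R n s.
pose S := oball (4 * r) `\` @oball R n r.
have mS : measurable S by exact: measurableD.
have sub : @oball R n r `<=` oball (4 * r).
  by move=> x; rewrite /oball/= => /lt_trans; apply; lra.
pose a0 := A * distortion e0 4 * r `^ e0 * expR (N * U r).
pose a1 := B * distortion e1 4 * r `^ e1 * expR (N * U r).
pose a2 := distortion e2 4 * r `^ e2 * expR (N * U r).
have d0 e : 0 <= distortion e 4 :> R by rewrite ltW// distortion_gt0.
have a00 : 0 <= a0 by rewrite /a0 !mulr_ge0 ?powR_ge0 ?expR_ge0.
have a10 : 0 <= a1 by rewrite /a1 !mulr_ge0 ?powR_ge0 ?expR_ge0.
have a20 : 0 <= a2 by rewrite /a2 !mulr_ge0 ?powR_ge0 ?expR_ge0.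
have split_ : (\int[mu]_(x in oball (4 * r)) (K x)%:E =
    \int[mu]_(x in oball r) (K x)%:E + \int[mu]_(x in S) (K x)%:E)%E.
  rewrite -ge0_integral_setU//.
  - by rewrite /S setDUK.
  - exact: measurable_funTS.
  - by move=> x _; rewrite lee_fin.
  - by rewrite /S disj_set2E setDIK.
have massS : ((m (4 * r) - m r)%:E = \int[mu]_(x in S) (K x)%:E)%E.
  move: split_; rewrite !ball_massE// => split_.
  by rewrite EFinB split_ addeAC subee ?add0e.
rewrite -lee_fin massS.
apply: (@le_trans _ _ (\int[mu]_(x in S) ((a0 + a1)%:E + a2%:E * (h x)%:E))%E).
  apply: ae_ge0_le_integral => //.
  - by move=> x _; rewrite lee_fin.
  - exact: measurable_funTS.
  - by move=> x _; rewrite -EFinM -EFinD lee_fin !addr_ge0// mulr_ge0.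
  - apply: measurable_funTS; apply: emeasurable_funD; first exact: measurable_cst.
    by apply: measurable_funeM; exact/measurable_EFinP.
  apply: filterS Kup => x Kx [x4 /negP xr]; rewrite -EFinM -EFinD lee_fin.
  rewrite /oball/= in x4 xr; rewrite -leNgt in xr.
  apply: (le_trans (Kx (lt_le_trans r0 xr))).
  have px e : enorm x `^ e <= distortion e 4 * r `^ e.
    have rng : r / 4 <= enorm x <= r * 4 by apply/andP; split; lra.
    by have /andP[] := @powR_distortion R e 4 r (enorm x) (ler1n R 4) r0 rng.
  apply: (@le_trans _ _ ((A * enorm x `^ e0 + B * enorm x `^ e1
      + h x * enorm x `^ e2) * expR (N * U r))).
    rewrite ler_wpM2l//.
      by rewrite !addr_ge0// mulr_ge0// powR_ge0.
    by rewrite ler_expR ler_wpM2l ?(ltW N0)// (profileE i01 radu x) U_noninc.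
  rewrite /a0 /a1 /a2.
  rewrite [leRHS](_ : _ = (A * (distortion e0 4 * r `^ e0)
    + B * (distortion e1 4 * r `^ e1) + h x * (distortion e2 4 * r `^ e2))
    * expR (N * U r)); last by ring.
  by rewrite ler_wpM2r ?expR_ge0// !lerD// ler_wpM2l.
rewrite ge0_integralD//; last 3 first.
- by move=> x _; rewrite lee_fin addr_ge0.
- by move=> x _; rewrite -EFinM lee_fin mulr_ge0.
- by apply: measurable_funTS; apply: measurable_funeM; exact/measurable_EFinP.
rewrite [leRHS]EFinD; apply: leeD.
  rewrite integral_cst//.
  apply: (@le_trans _ _ ((a0 + a1)%:E * ((8 * r) ^+ n)%:E)%E).
    rewrite lee_wpmul2l ?lee_fin ?addr_ge0//.
    rewrite (_ : 8 * r = 2 * (4 * r)); last by ring.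
    apply: le_trans (volume_oball_le _ (ltW r40)).
    by apply: le_measure; rewrite ?inE//; exact: subDsetl.
  rewrite -EFinM lee_fin !weightD// /N !powR_mulrn ?(ltW r0)// -/N /a0 /a1 /weight.
  by rewrite exprMn le_eqVlt; apply/orP; left; apply/eqP; ring.
rewrite ge0_integralZl//; last 2 first.
- by apply: measurable_funTS; exact/measurable_EFinP.
- by move=> x _; rewrite lee_fin.
apply: (@le_trans _ _ (a2%:E * b%:E)%E).
  rewrite lee_wpmul2l ?lee_fin// -hb.
  apply: ge0_subset_integral => //; first exact/measurable_EFinP.
  by move=> x _; rewrite lee_fin.
by rewrite -EFinM lee_fin /a2 /weight le_eqVlt; apply/orP; left; apply/eqP; ring.
Qed.

End shell_mass.

(** * Explicit constants and the theorem *)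

Section curvature_cap.
Context (R : realType).
Implicit Types (n : nat) (p M alpha a b : R).

Definition low_const n p alpha : R :=
  (distortion (`|n%:R * alpha| + p) (8 * n%:R))^-1 / (8 * n%:R) ^+ n.

Definition up_const n p M alpha a b : R :=
  distortion (`|n%:R * alpha| + p + n%:R) 4 * (8 ^+ n * (a + M) + b).

(** The cap of [radial_mass_bound] for the exponents n (1 + alpha) and
    n (1 + alpha) + p; the maximum with 1 makes it positive for all parameters. *)
Definition curvature_cap n p M alpha a b : R :=
  Num.max 1 (mass_cap n%:R (ln 2 / gamma_const R n) (low_const n p alpha)
    (up_const n p M alpha a b) (n%:R * alpha + n%:R) (n%:R * alpha + p + n%:R)).

Lemma curvature_cap_gt0 n p M alpha a b : 0 < curvature_cap n p M alpha a b.
Proof. by rewrite lt_max ltr01. Qed.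

End curvature_cap.

Section norms.
Context (R : realType) (n : nat).
Let mu := lebesgue_Rn R n.

Lemma Linfty_ball_bound (Q : Rn R n -> R) : Linfty_loc Q ->
  \forall x \ae mu, enorm x < 1 -> `|Q x| <= fine (Lnorm_on +oo (oball 1) Q).
Proof.
move=> [mQ /(_ 1)]; rewrite /Lnorm_on; set f := _ \_ _ => Lfin.
have L0 : (0 <= Lnorm mu +oo f)%E by exact: Lnorm_ge0.
have Lnum : Lnorm mu +oo f \is a fin_num by rewrite ge0_fin_numE.
have muT : (0 < mu setT)%E.
  apply: (@lt_le_trans _ _ (mu (@box R n 0 1))).
    by rewrite /mu volume_box// subr0 expr1n lte_fin.
  by apply: le_measure; rewrite ?inE//; exact: measurable_box.
have LE : Lnorm mu +oo f = ess_sup mu (abse \o f).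
  by rewrite unlock /Lnorm muT.
have := ess_sup_ge mu (abse \o f); apply: filterS => x fx x1.
rewrite -lee_fin fineK// LE; apply: le_trans fx.
by rewrite /f /= patchE mem_set.
Qed.

Lemma L1_outside_ball (g : Rn R n -> R) : (forall x, 0 <= g x) ->
  mu.-integrable setT (EFin \o g) ->
  (\int[mu]_x (g x * \1_(~` oball 1) x)%:E =
   (fine (Lnorm_on 1 (~` oball 1) g))%:E)%E.
Proof.
move=> g0 intg; have mo : measurable (~` @oball R n 1).
  by apply: measurableC; exact: measurable_oball.
rewrite /Lnorm_on Lnorm1.
have -> : (fun x => `|((EFin \o g) \_ (~` oball 1)) x|)%E =
    (fun x => (g x * \1_(~` oball 1) x)%:E).
  apply/funext => x; rewrite patchE indicE; case: ifPn => _.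
    by rewrite /= ger0_norm// mulr1.
  by rewrite mulr0 abse0.
rewrite fineK// -(integral_fin_num_abs mu measurableT); last first.
  apply: measurable_funM; last exact: measurable_indic.
  by apply/measurable_EFinP; exact: measurable_int intg.
have /integrableP[mg] := intg; apply: le_lt_trans.
apply: ge0_le_integral => //.
- apply: measurableT_comp => //; apply/measurable_EFinP.
  apply: measurable_funM; last exact: measurable_indic.
  by apply/measurable_EFinP.
- exact: measurableT_comp.
move=> x _ /=; rewrite lee_fin normrM ler_piMr// indicE.
by case: (_ \in _); rewrite ?normr1 ?normr0.
Qed.

End norms.

Section total_mass.
Context (R : realType) (n : nat).
Let mu := lebesgue_Rn R n.

Lemma total_mass_le (K : Rn R n -> R) C : (forall y, 0 <= K y) ->
  mu.-integrable setT (EFin \o K) ->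
  (forall r, 0 < r -> ball_mass K r <= C) -> (\int[mu]_y (K y)%:E <= C%:E)%E.
Proof.
move=> K0 intK mC.
have mo r := @measurable_oball R n r.
have mK : measurable_fun setT (EFin \o K) by exact: measurable_int intK.
have bigcupT : \bigcup_i @oball R n i.+1%:R = setT.
  apply/seteqP; split=> // x _; exists (Num.truncn (enorm x)) => //.
  by rewrite /oball/= truncnS_gt.
have cv : (\int[mu]_(y in oball k.+1%:R) (K y)%:E @[k --> \oo] -->
    \int[mu]_(y in \bigcup_k @oball R n k.+1%:R) (K y)%:E)%E.
  apply: (@ge0_nondecreasing_set_cvg_integral _ _ R
      (fun k => @oball R n k.+1%:R) (EFin \o K) mu) => //.
  - move=> i j ij; apply/subsetPset => x; rewrite /oball/= => /lt_le_trans; apply.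
    by rewrite ler_nat ltnS.
  - by move=> k; exact: measurable_funTS.
  - by move=> k x _; rewrite lee_fin.
rewrite bigcupT in cv.
apply: (cvge_le _ cv); apply: nearW => k; rewrite ball_massE// lee_fin.
exact: mC.
Qed.

End total_mass.

Theorem theorem1p5 (R : realType) :
  exists C : nat -> R -> R -> R -> R -> R -> R,
    (forall (n : nat) (p M alpha a b : R), 0 < C n p M alpha a b) /\
    forall (n : nat) (Q : Rn R n -> R) (p M : R),
      (2 <= n)%N ->
      Linfty_loc Q ->
      ae_radial Q ->
      0 <= p ->
      1 <= M ->
      (\forall x \ae lebesgue_Rn R n, 1 + enorm x `^ p <= Q x) ->
      (lebesgue_Rn R n).-integrable setT (EFin \o excess p M Q) ->
      forall alpha : R, -1 < alpha ->
      forall u : Rn R n -> R,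
        radial u ->
        normal_solution alpha Q u ->
        (\int[lebesgue_Rn R n]_x
           (enorm x `^ (n%:R * alpha) * `|Q x| * expR (n%:R * u x))%:E
           < +oo)%E ->
        (\int[lebesgue_Rn R n]_x
           (curvature_density alpha Q u x)%:E
         <= (C n p M alpha
               (fine (Lnorm_on +oo (oball 1) Q))
               (fine (Lnorm_on 1 (~` oball 1) (excess p M Q))))%:E)%E.
Proof.
exists (@curvature_cap R); split.
  by move=> *; exact: curvature_cap_gt0.
move=> n Q p M n2 LQ _ p0 M1 Qlow intex alpha alpha1 u radu [meas_u [c eq_u]] finK.
set a := fine (Lnorm_on +oo _ _); set b := fine (Lnorm_on 1 _ _).
pose mu := lebesgue_Rn R n; pose N : R := n%:R.
have N0 : 0 < N by rewrite ltr0n (leq_trans _ n2).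
have mQ : measurable_fun setT Q by case: LQ.
have me e : measurable_fun setT (fun x : Rn R n => enorm x `^ e).
  exact: (measurableT_comp (measurable_powR e) (@measurable_enorm R n)).
have mexp : measurable_fun setT (fun x => expR (N * u x)).
  by apply: (measurableT_comp (@measurable_expR R)); exact: measurable_funM.
pose K x := enorm x `^ (N * alpha) * `|Q x| * expR (N * u x).
have K0 x : 0 <= K x by rewrite !mulr_ge0 ?powR_ge0 ?expR_ge0.
have mK : measurable_fun setT K.
  apply: measurable_funM => //; apply: measurable_funM => //.
  exact: measurableT_comp.
have mD : measurable_fun setT (curvature_density alpha Q u).
  by apply: measurable_funM => //; exact: measurable_funM.
have intK : mu.-integrable setT (EFin \o K).
  apply/integrableP; split; first exact/measurable_EFinP.
  by under eq_integral do rewrite /= ger0_norm//.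
have Qae : \forall x \ae mu, `|Q x| = Q x.
  apply: filterS Qlow => x h; rewrite ger0_norm// (le_trans _ h)//.
  by rewrite addr_ge0// powR_ge0.
have KD : \forall x \ae mu, curvature_density alpha Q u x = K x.
  by apply: filterS Qae => x Qx; rewrite /K Qx.
have g0 : 0 < gamma_const R n by apply: gamma_const_gt0; exact: ltnW.
have eq_K x : ((u x)%:E = ((gamma_const R n)^-1)%:E *
    (\int[mu]_y (log_kernel x y * K y)%:E) + c%:E)%E.
  rewrite eq_u; congr (_ * _ + _)%E; apply: ae_eq_integral => //.
  - apply/measurable_EFinP; apply: measurable_funM => //.
    by apply: measurable_log_kernel => i; [exact: measurable_cst|exact: measurable_tnth].
  - apply/measurable_EFinP; apply: measurable_funM => //.
    by apply: measurable_log_kernel => i; [exact: measurable_cst|exact: measurable_tnth].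
  by apply: filterS KD => y Ky _; rewrite Ky.
have -> : (\int[lebesgue_Rn R n]_x (curvature_density alpha Q u x)%:E =
    \int[mu]_x (K x)%:E)%E.
  apply: ae_eq_integral => //; [exact/measurable_EFinP|exact/measurable_EFinP|].
  by apply: filterS KD => y Ky _; rewrite Ky.
apply: total_mass_le => // r r0.
pose i0 : 'I_n := Ordinal (ltnW n2); pose i1 : 'I_n := Ordinal n2.
have i01 : i0 != i1 by [].
pose U := profile i0 i1 u.
have U_noninc := @profile_noninc R n i0 i1 i01 K u _ c g0 K0 intK radu eq_K.
have U_drop := @profile_drop R n i0 i1 i01 K u _ c g0 K0 intK radu eq_K.
have a0 : 0 <= a by rewrite fine_ge0// Lnorm_ge0.
have b0 : 0 <= b by rewrite fine_ge0// Lnorm_ge0.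
pose e0 := N * alpha; pose e1 := N * alpha + p.
have N8 : 1 <= 8 * N.
  have : 2 <= n%:R :> R by rewrite ler_nat.
  by rewrite /N; lra.
have e0le : `|e0| <= `|e0| + p by rewrite lerDl.
have e1le : `|e1| <= `|e0| + p.
  by rewrite (le_trans (ler_normD _ _))// (ger0_norm p0).
have np : 0 <= `|e0| + p by rewrite addr_ge0.
have low e : `|e| <= `|e0| + p ->
  (\forall x \ae mu, 0 < enorm x -> enorm x `^ e * expR (N * u x) <= K x) ->
  forall s, 0 < s -> low_const n p alpha * weight U N (e + N) s <= ball_mass K (s / 4).
  move=> ele Ke s s0.
  have := @ball_mass_low R n i0 i1 i01 K u n2 K0 intK radu U_noninc e s s0 Ke.
  apply: le_trans; rewrite ler_wpM2r ?(ltW (weight_gt0 _ _ _ s0))//.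
  have N0' := ltW N0.
  rewrite /low_const -/N -/e0 ler_wpM2r ?invr_ge0 ?exprn_ge0 ?mulr_ge0//.
  rewrite lef_pV2 ?posrE ?distortion_gt0// distortion_le//.
  by rewrite (ger0_norm np).
have low0 : \forall x \ae mu, 0 < enorm x -> enorm x `^ e0 * expR (N * u x) <= K x.
  apply: filterS Qlow => x Qx x0; rewrite /K ler_wpM2r ?expR_ge0//.
  rewrite ler_peMr ?powR_ge0//; apply: le_trans (ler_norm _).
  by apply: le_trans Qx; rewrite lerDl powR_ge0.
have low1 : \forall x \ae mu, 0 < enorm x -> enorm x `^ e1 * expR (N * u x) <= K x.
  apply: filterS Qlow => x Qx x0; rewrite /K ler_wpM2r ?expR_ge0//.
  rewrite /e1 powRD; last by rewrite (gt_eqF x0) implybT.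
  rewrite ler_wpM2l ?powR_ge0//; apply: le_trans (ler_norm _).
  by apply: le_trans Qx; rewrite lerDr.
pose h x := excess p M Q x * \1_(~` @oball R n 1) x.
have ex0 x : 0 <= excess p M Q x by rewrite /excess le_max lexx orbT.
have h0 x : 0 <= h x by rewrite mulr_ge0.
have mh : measurable_fun setT h.
  apply: measurable_funM; last first.
    by apply: measurable_indic; apply: measurableC; exact: measurable_oball.
  by apply/measurable_EFinP; exact: measurable_int intex.
have hb : (\int[mu]_x (h x)%:E = b%:E)%E by exact: L1_outside_ball.
have up : \forall x \ae mu, 0 < enorm x ->
    K x <= (a * enorm x `^ e0 + M * enorm x `^ e1 + h x * enorm x `^ (e0 + N))
           * expR (N * u x).
  have QL := Linfty_ball_bound LQ.
  apply: filterS2 QL Qae => x QL Qx x0.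
  rewrite /K -/e0 ler_wpM2r ?expR_ge0//.
  have M0 : 0 <= M by lra.
  (* Inside the unit ball Q is bounded by its sup norm.  Outside, the factor
     |x|^(n alpha) of the excess over M |x|^p is at most |x|^(n alpha + n), which
     makes the excess count with the weight of exponent n (1 + alpha). *)
  have [x1|x1] := ltP (enorm x) 1.
    apply: (@le_trans _ _ (a * enorm x `^ e0)).
      by rewrite mulrC ler_wpM2r ?powR_ge0// QL.
    by rewrite -addrA lerDl addr_ge0// mulr_ge0// powR_ge0.
  have -> : h x = excess p M Q x.
    rewrite /h indicE mem_set ?mulr1// /oball/=.
    by apply/negP; rewrite -leNgt.
  rewrite /e1 !powRD; try by rewrite (gt_eqF x0) implybT.
  rewrite Qx; set y := enorm x `^ e0; have y0 : 0 <= y by exact: powR_ge0.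
  have xN : 1 <= enorm x `^ N by rewrite powR_mulrn ?(ltW x0)// exprn_ege1.
  have Qex : Q x <= M * enorm x `^ p + excess p M Q x.
    by rewrite /excess -lerBlDl le_max lexx.
  have h1 := ler_wpM2l y0 Qex.
  have h2 : y * excess p M Q x <= excess p M Q x * (y * enorm x `^ N).
    by rewrite mulrCA ler_wpM2l// ler_peMr.
  have h3 : 0 <= a * y by exact: mulr_ge0.
  lra.
have D0 e : 0 < distortion e 4 :> R by exact: distortion_gt0.
pose E := up_const n p M alpha a b.
have M0 : 0 <= M by lra.
have E0 : 0 <= E.
  by rewrite mulr_ge0 ?(ltW (D0 _))// addr_ge0// mulr_ge0 ?exprn_ge0// addr_ge0.
have m_up s : 0 < s -> ball_mass K (4 * s) - ball_mass K s <=
    E * (weight U N (e0 + N) s + weight U N (e1 + N) s).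
  move=> s0; have := @ball_mass_up R n i0 i1 i01 K u n2 K0 intK radu U_noninc
    e0 e1 (e0 + N) a M h s s0 a0 M0 h0 mh up b hb.
  move=> /le_trans; apply.
  have w0 := weight_gt0 U N (e0 + N) s0; have w1 := weight_gt0 U N (e1 + N) s0.
  have big : 0 <= `|e0| + p + N by rewrite addr_ge0// ltW.
  have dle e : `|e| <= `|e0| + p + N ->
      distortion e 4 <= distortion (`|e0| + p + N) 4 :> R.
    by move=> ele; rewrite distortion_le ?ler1n// (ger0_norm big).
  have N0' := ltW N0.
  have d0 : distortion e0 4 <= distortion (`|e0| + p + N) 4 :> R.
    by apply: dle; rewrite -addrA lerDl; exact: addr_ge0.
  have d1 : distortion e1 4 <= distortion (`|e0| + p + N) 4 :> R.
    by apply: dle; rewrite (le_trans e1le)// lerDl.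
  have d2 : distortion (e0 + N) 4 <= distortion (`|e0| + p + N) 4 :> R.
    apply: dle; rewrite (le_trans (ler_normD _ _))// (ger0_norm N0').
    by rewrite lerD2r lerDl.
  rewrite /E /up_const -/N -/e0.
  move: d0 d1 d2 (D0 e0) (D0 e1) (D0 (e0 + N)) (D0 (`|e0| + p + N)).
  set D := distortion (`|e0| + p + N) 4; move: (distortion e0 4) (distortion e1 4)
    (distortion (e0 + N) 4) => x y z xD yD zD x0 y0 z0 DD0.
  have t0 : 0 <= 8 ^+ n :> R by rewrite exprn_ge0.
  move: (8 ^+ n : R) t0 => t t0.
  move: (weight U N (e0 + N) s) (weight U N (e1 + N) s) w0 w1 => w0 w1 w00 w10.
  have ta := mulr_ge0 t0 a0; have tM := mulr_ge0 t0 M0.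
  have l0 : t * (a * x) * w0 <= t * a * D * w0.
    by rewrite mulrA ler_wpM2r ?(ltW w00)// ler_wpM2l.
  have l1 : t * (M * y) * w1 <= t * M * D * w1.
    by rewrite mulrA ler_wpM2r ?(ltW w10)// ler_wpM2l.
  have l2 : b * z * w0 <= b * D * w0.
    by rewrite ler_wpM2r ?(ltW w00)// ler_wpM2l.
  apply: (le_trans (lerD (lerD l0 l1) l2)).
  rewrite -subr_ge0 (_ : _ - _ = t * M * D * w0 + (t * a + b) * D * w1); last by ring.
  have D0' := ltW DD0; have w00' := ltW w00; have w10' := ltW w10.
  by apply: addr_ge0; repeat apply: mulr_ge0 => //; exact: addr_ge0.
have k00 : 0 < e0 + N.
  by rewrite /e0 -{2}[N]mulr1 -mulrDr mulr_gt0//; lra.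
have k10 : 0 < e1 + N by rewrite /e1 addrAC ltr_wpDr.
have c0 : 0 < low_const n p alpha.
  by rewrite divr_gt0 ?invr_gt0 ?distortion_gt0// exprn_gt0// mulr_gt0.
have d0 : 0 < ln 2 / gamma_const R n by rewrite divr_gt0// ln2_gt0.
have mLam s : ball_mass K s <= fine (\int[mu]_x (K x)%:E)%E.
  rewrite -lee_fin -ball_massE// fineK; last first.
    exact: (integrable_fin_num measurableT intK).
  apply: ge0_subset_integral => //; first exact: measurable_oball.
    exact/measurable_EFinP.
  by move=> x _; rewrite lee_fin.
rewrite /curvature_cap le_max; apply/orP; right.
exact: (@radial_mass_bound R (ball_mass K) U N (ln 2 / gamma_const R n)
  (low_const n p alpha) E _ N0 d0 c0 E0 mLam U_drop _ _ k00 k10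
  (low e0 e0le low0) (low e1 e1le low1) m_up r r0).
Qed.
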